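(* Assume there is a Borel function $h:\mathrm{TS}\times\mathcal P(\mathbb S)\times\mathbb R^S\to\mathbb A^S$ with $h^i(t,u,m,v)\in\operatorname{argmax}_{a\in\mathbb A}\{\psi^i(t,Z(u),m,a)+\sum_jQ^{ij}(t,Z(u),m,a)v^j\}$ for all $i,(t,u),m,v$, and set $\hat Q^{ij}(t,u,m,v)=Q^{ij}(t,Z(u),m,h^i(t,u,m,v))$, $\hat\psi^i(t,u,m,v)=\psi^i(t,Z(u),m,h^i(t,u,m,v))$. Assume that $\hat\psi$ and $\hat Q$ are Lipschitz in $(m,v)$ uniformly in $(t,u)$, that $\Psi(k,\cdot)$ and $\lambda^k(t,\cdot)$ are Lipschitz in $m$ uniformly in $k,t$, and that the relocation function $J^i(t,m)$ does not depend on $m$ (write $J^i(t)$). Let $m_0\in\mathcal P(\mathbb S)$. Then, for $T>0$ sufficiently small (in terms of $n$, $S$, the Lipschitz constants and the uniform bounds of the coefficients), there exists a unique pair $(\mu,v)$ of regular functions $\mu:\mathrm{TS}\to\mathcal P(\mathbb S)$, $v:\mathrm{TS}\to\mathbb R^S$ satisfying, for all $i\in\mathbb S$ and $(t,u)\in\mathrm{TS}$ (in the Carathéodory sense in $t$), (E1) $\frac{\partial}{\partial t}v^i(t,u)=-\hat\psi^i(t,u,\mu(t,u),v(t,u))-\sum_j\hat Q^{ij}(t,u,\mu(t,u),v(t,u))v^j(t,u)-\mathbb I_{\{Z(u)<n\}}\lambda^{Z(u)+1}(t,\mu(t,u))\big(v^{J^i(t)}(t,\overrightarrow{(u,t)})-v^i(t,u)\big)$,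 (E2) $\frac{\partial}{\partial t}\mu^i(t,u)=\sum_j\mu^j(t,u)\hat Q^{ji}(t,u,\mu(t,u),v(t,u))$, (E3) $v(T,u)=\Psi(Z(u),\mu(T,u))$, (E4) $\mu(0,u_0)=m_0$, (E5) $\mu(t_u,u)=\mu(t_u,\overleftarrow u)\,\big(\mathbb I_{\{J^i(t_u)=j\}}\big)_{i,j\in\mathbb S}$ for every $u$ with $Z(u)\ge1$, where $t_u=u^{Z(u)}$ (row vector times matrix).
   Context: $\mathbb S=\{1,\dots,S\}$, $\mathbb A\subseteq\mathbb R^A$, $n\in\mathbb N$, $T>0$; $\mathcal P(\mathbb S)$ is the probability simplex in $\mathbb R^S$ (row vectors). Bounded Borel coefficients: $\lambda=(\lambda^1,\dots,\lambda^n):[0,T]\times\mathcal P(\mathbb S)\to(0,\infty)^n$ (shock intensities), $Q:[0,T]\times\{0,\dots,n\}\times\mathcal P(\mathbb S)\times\mathbb A\to\mathbb R^{S\times S}$ (intensity matrices: off-diagonal $\ge0$, row sums $0$), $\psi:[0,T]\times\{0,\dots,n\}\times\mathcal P(\mathbb S)\times\mathbb A\to\mathbb R^S$, $\Psi:\{0,\dots,n\}\times\mathcal P(\mathbb S)\to\mathbb R^S$, $J:[0,T]\times\mathcal P(\mathbb S)\to\mathbb S^{\mathbb S}$. $\mathbb U$ is the set of $u\in(\{-1\}\cup[0,T])^n$ such that for some $k\in\{0,\dots,n\}$, $0\le u^1\le\dots\le u^k$ and $u^{k+1}=\dots=u^n=-1$; $Z(u)$ denotes this $k$; $u_0=(-1,\dots,-1)$.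 $\mathrm{TS}=\{(t,u)\in[0,T]\times\mathbb U:\max_ku^k\le t\}$. A function on $\mathrm{TS}$ is regular if for each $u$ it is absolutely continuous in $t$ on $\{t:(t,u)\in\mathrm{TS}\}$. For $Z(u)<n$ and $t\ge\max_ku^k$, $\overrightarrow{(u,t)}$ is $u$ with entry $Z(u)+1$ replaced by $t$; for $Z(u)\ge1$, $\overleftarrow u$ is $u$ with entry $Z(u)$ replaced by $-1$. (Interpretation: $u$ records the times of the common shocks that have occurred; $v$ is the value function and $\mu$ the aggregate distribution in equilibrium.) *)

(* Defs.v *)
From HB Require Import structures.
From mathcomp Require Import all_boot all_order all_algebra.
From mathcomp Require Import all_classical all_reals all_analysis.
Set Implicit Arguments. Unset Strict Implicit. Unset Printing Implicit Defensive.
Import Order.TTheory GRing.Theory Num.Theory.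
Import numFieldNormedType.Exports.
Local Open Scope classical_set_scope.
Local Open Scope ring_scope.

Section Defs.
Variable R : realType.

Definition borel_set (X : topologicalType) (A : set X) : Prop := <<s open >> A.

(* (trace sigma-algebra on the domain D) *)
Definition borel_fun (X Y : topologicalType) (D : set X) (f : X -> Y) : Prop :=
  forall B : set Y, borel_set B ->
    exists C : set X, borel_set C /\ D `&` f @^-1` B = D `&` C.

Definition inP (S : nat) (m : 'rV[R]_S) : Prop :=
  (forall i, 0 <= m 0 i) /\ \sum_i m 0 i = 1.

Definition l1 (S : nat) (x : 'rV[R]_S) : R := \sum_i `|x 0 i|.

(* the set U (entries indexed 0..n-1 instead of 1..n) *)
Definition inU (n : nat) (T : R) (u : 'rV[R]_n) : Prop :=
  (forall i, u 0 i = -1 \/ (0 <= u 0 i /\ u 0 i <= T)) /\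
  exists k, (k <= n)%N /\
    (forall i : 'I_n, (i < k)%N -> 0 <= u 0 i) /\
    (forall i j : 'I_n, (i <= j)%N -> (j < k)%N -> u 0 i <= u 0 j) /\
    (forall i : 'I_n, (k <= i)%N -> u 0 i = -1).

(* Z(u): number of shocks that occurred *)
Definition Zn (n : nat) (u : 'rV[R]_n) : nat := #|[pred i : 'I_n | u 0 i != -1]|.
Definition Zo (n : nat) (u : 'rV[R]_n) : 'I_n.+1 := inord (Zn u).

Definition u0 (n : nat) : 'rV[R]_n := const_mx (-1).

Definition inTS (n : nat) (T t : R) (u : 'rV[R]_n) : Prop :=
  0 <= t /\ t <= T /\ inU T u /\ forall i, u 0 i <= t.

(* \overrightarrow{(u,t)} : entry Z(u)+1 (0-based index Z(u)) replaced by t *)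
Definition ushift (n : nat) (u : 'rV[R]_n) (t : R) : 'rV[R]_n :=
  \row_i (if (i : nat) == Zn u then t else u 0 i).
(* \overleftarrow u : entry Z(u) (0-based index Z(u)-1) replaced by -1 *)
Definition uback (n : nat) (u : 'rV[R]_n) : 'rV[R]_n :=
  \row_i (if (i.+1 == Zn u)%N then -1 else u 0 i).

Definition abs_cont_on (I : set R) (f : R -> R) : Prop :=
  forall e : R, 0 < e -> exists d : R, 0 < d /\
    forall (k : nat) (x y : 'I_k -> R),
      (forall i, I (x i) /\ I (y i) /\ x i <= y i) ->
      (forall i j, i != j -> y i <= x j \/ y j <= x i) ->
      \sum_i (y i - x i) < d -> \sum_i `|f (y i) - f (x i)| < e.

(* t_u = u^{Z(u)} (0-based index Z(u)-1); only used when Z(u) >= 1 *)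
Definition tlast (n : nat) (u : 'rV[R]_n) : R :=
  match (insub (Zn u).-1 : option 'I_n) with Some k => u 0 k | None => 0 end.

Section Model.
Variables (n S dA : nat) (T : R).
Variables (lam : R -> 'rV[R]_S -> 'rV[R]_n)  (* lam t m 0 k = lambda^{k+1}(t,m) *)
          (Q : R -> 'I_n.+1 -> 'rV[R]_S -> 'rV[R]_dA -> 'M[R]_S)
          (psi : R -> 'I_n.+1 -> 'rV[R]_S -> 'rV[R]_dA -> 'rV[R]_S)
          (Psi : 'I_n.+1 -> 'rV[R]_S -> 'rV[R]_S)
          (J : R -> 'I_S -> 'I_S)
          (h : R -> 'rV[R]_n -> 'rV[R]_S -> 'rV[R]_S -> 'M[R]_(S, dA)).
                                    (* row i of h = h^i *)

Definition Qhat (t : R) (u : 'rV[R]_n) (m v : 'rV[R]_S) (i j : 'I_S) : R :=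
  Q t (Zo u) m (row i (h t u m v)) i j.
Definition psihat (t : R) (u : 'rV[R]_n) (m v : 'rV[R]_S) (i : 'I_S) : R :=
  psi t (Zo u) m (row i (h t u m v)) 0 i.

Variables (mu v : R -> 'rV[R]_n -> 'rV[R]_S).

Definition jump_term (t : R) (u : 'rV[R]_n) (i : 'I_S) : R :=
  match (insub (Zn u) : option 'I_n) with
  | Some k => lam t (mu t u) 0 k * (v t (ushift u t) 0 (J t i) - v t u 0 i)
  | None => 0
  end.

Definition rhs_v (t : R) (u : 'rV[R]_n) (i : 'I_S) : R :=
  - psihat t u (mu t u) (v t u) i
  - \sum_j Qhat t u (mu t u) (v t u) i j * v t u 0 j
  - jump_term t u i.

Definition rhs_mu (t : R) (u : 'rV[R]_n) (i : 'I_S) : R :=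
  \sum_j mu t u 0 j * Qhat t u (mu t u) (v t u) j i.

Definition is_solution (m0 : 'rV[R]_S) : Prop :=
  (forall t u, inTS T t u -> inP (mu t u)) /\
  (* regularity: absolutely continuous in t on {t | (t,u) in TS} *)
  (forall u, inU T u -> forall i,
     abs_cont_on [set t | inTS T t u] (fun t => mu t u 0 i) /\
     abs_cont_on [set t | inTS T t u] (fun t => v t u 0 i)) /\
  (* (E1), Caratheodory sense: a.e. in t *)
  (forall u, inU T u -> forall i,
     {ae (@lebesgue_measure R), forall t, inTS T t u ->
        is_derive t (1 : R) (fun s => v s u 0 i) (rhs_v t u i)}) /\
  (forall u, inU T u -> forall i,
     {ae (@lebesgue_measure R), forall t, inTS T t u ->
        is_derive t (1 : R) (fun s => mu s u 0 i) (rhs_mu t u i)}) /\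
  (forall u, inU T u -> v T u = Psi (Zo u) (mu T u)) /\
  mu 0 (u0 n) = m0 /\
  (forall u, inU T u -> (1 <= Zn u)%N ->
     mu (tlast u) u =
     mu (tlast u) (uback u) *m \matrix_(i, j) (J (tlast u) i == j)%:R).

End Model.
End Defs.

(* Main.v *)
Require Import Defs.
From HB Require Import structures.
From mathcomp Require Import all_boot all_order all_algebra.
From mathcomp Require Import all_classical all_reals all_analysis.
From mathcomp Require Import measurable_realfun lra.
Set Implicit Arguments. Unset Strict Implicit. Unset Printing Implicit Defensive.
Import Order.TTheory GRing.Theory Num.Theory.
Import numFieldNormedType.Exports.
Local Open Scope classical_set_scope.
Local Open Scope ring_scope.

(** Both existence and uniqueness come from one contraction. A Picard step sends a pair [(mu, v)]
to the pair [(nu, w)] whose equations have their right-hand sides, terminal condition and jump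
conditions evaluated at [(mu, v)]; solutions are its fixed points. For small [T] the step
halves the distance in which [mu] is weighted by [4 ^ Z(u)] (so that the transfer of the
distribution at a shock, which is only 1-Lipschitz, becomes contracting) and [v] by a multiple
of the Lipschitz constant of the terminal cost. The equation for [nu] is solved for
[exp(c t) nu], with [c] a bound of the intensities, which keeps [nu] in the simplex.

The distance estimate uses only that an absolutely continuous function whose derivative is
almost everywhere bounded by [M] is [M]-Lipschitz, so it applies to arbitrary solutions, which
need not be measurable in [u]. Joint measurability in [(t, u)] is needed only to perform a
step, because of the diagonal term [v(t, (u, t))]: the iterates are jointly measurable by the
Fubini-Tonelli theorem, and the almost everywhere equations come from Lebesgue
differentiation. *)

(** * Absolutely continuous functions *)

(** The products of [Qhat] with [v] and of [lam] with the jump of [v] are only locally Lipschitz in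
    [v], so the contraction lives on a ball of radius [Bv]. The iterates stay in it, since the
    terminal cost is bounded by [k0] and a short horizon adds at most one. An arbitrary solution is
    only absolutely continuous along each single history, without any bound uniform in [u]; it is
    brought into the ball by induction on the number of shocks still to come, because the equation
    along [u] involves, besides [v] along [u] itself, only values right after the next shock. The
    distance is never formed as a supremum: [near_states D] says pointwise that [D] is an admissible
    bound, and repeated halving of [D] replaces the fixed-point theorem of Banach. The pointwise
    limit of the iterates is jointly measurable, which allows one further step from it; the
    resulting absolutely continuous pair agrees with the limit on [TS] and is the solution. *)

Section AbsCont.
Variable R : realType.
Implicit Types (f : R -> R) (I : set R).
Local Notation leb := (@lebesgue_measure R).

Lemma ae_impl (P Q : R -> Prop) : (forall t, P t -> Q t) ->
  {ae leb, forall t, P t} -> {ae leb, forall t, Q t}.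
Proof. by move=> PQ; apply: filterS => //; exact: (ae_filter_ringOfSetsType leb). Qed.

Lemma ae_conj (P Q : R -> Prop) : {ae leb, forall t, P t} -> {ae leb, forall t, Q t} ->
  {ae leb, forall t, P t /\ Q t}.
Proof. by move=> aP aQ; apply: filterI => //; exact: (ae_filter_ringOfSetsType leb). Qed.

Lemma lebesgue_measure_le (A B : set R) : measurable A -> measurable B -> A `<=` B ->
  (leb A <= leb B)%E.
Proof. by move=> mA mB AB; apply: le_measure => //; rewrite inE; [exact: mA|exact: mB]. Qed.

Lemma is_derive_near_bound f (x d M : R) : is_derive x (1:R) f d -> `|d| < M ->
  exists2 e : R, 0 < e & forall z, `|z - x| < e -> `|f z - f x| <= M * `|z - x|.
Proof.
move=> df dM.
have := @ex_derive _ _ _ _ _ _ _ df.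
have := @derive_val _ _ _ _ _ _ _ df.
rewrite /derivable /derive => dv /cvg_ex[l hl].
have ld : l = d by rewrite -dv; apply/esym; apply: cvg_lim hl => //.
move: hl; rewrite ld => /cvgrPdist_lt /(_ (M - `|d|)).
rewrite subr_gt0 => /(_ dM).
move=> /nbhs_ballP[e e0 he].
exists e => // z zx.
have [->|zneq] := eqVneq z x; first by rewrite !subrr normr0 mulr0.
have z0 : z - x != 0 by rewrite subr_eq0.
have := he (z - x); rewrite /ball/= sub0r normrN => /(_ zx z0).
rewrite [_ *: 1]mulr1 subrK => h1.
have := ler_distD (d) (((z - x)^-1 *: (f z - f x))) 0.
rewrite !subr0 distrC => h2.
have h3 : `|(z - x)^-1 *: (f z - f x)| <= M.
  by apply: le_trans h2 _; rewrite -lerBrDr; exact: ltW.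
move: h3; rewrite normrZ normfV -ler_pdivlMl ?invr_gt0 ?normr_gt0//.
by rewrite invrK mulrC.
Qed.

(* Creeping argument: up to the supremum reached so far, [f] grows at rate at most [M]
   except on finitely many intervals inside the open cover [V] of the exceptional set. *)
Lemma open_cover_bound f (a b M : R) (V : set R) : a <= b -> 0 <= M -> open V ->
  (leb V < +oo)%E ->
  (forall x, a <= x <= b -> V x \/ exists2 e : R, 0 < e &
      forall z, `|z - x| < e -> `|f z - f x| <= M * `|z - x|) ->
  exists k (x y : 'I_k -> R),
    [/\ forall i, [/\ a <= x i, x i <= y i & y i <= b],
        forall i j, i != j -> y i <= x j \/ y j <= x i,
        \sum_i (y i - x i) <= fine (leb V) &
        `|f b - f a| <= M * (b - a) + \sum_i `|f (y i) - f (x i)|].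
Proof.
move=> ab M0 oV Vfin H.
have mV : measurable V by exact: open_measurable.
pose g z := leb (V `&` `[a, z]).
have mI z : measurable (V `&` `[a, z]) by apply: measurableI.
have gfin z : g z \is a fin_num.
  rewrite ge0_fin_numE; last exact: measure_ge0.
  by apply: le_lt_trans Vfin; apply: lebesgue_measure_le => //; exact: subIsetl.
(* [good z] carries a budget: the intervals used so far have total length at most the measure of [V]
   up to [z], so a new interval inside [V] pays for itself. *)
pose good z := exists k (x y : 'I_k -> R),
    [/\ forall i, [/\ a <= x i, x i <= y i & y i <= z],
        forall i j, i != j -> y i <= x j \/ y j <= x i,
        \sum_i (y i - x i) <= fine (g z) &
        `|f z - f a| <= M * (z - a) + \sum_i `|f (y i) - f (x i)|].
have gmono p q : p <= q -> fine (g p) <= fine (g q).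
  move=> pq; apply: fine_le => //; apply: lebesgue_measure_le => //.
  by apply: setIS; apply: subset_itvl; rewrite bnd_simp.
have good1 p q : good p -> a <= p <= q -> `|f q - f p| <= M * (q - p) -> good q.
  move=> [k [x [y [h1 h2 h3 h4]]]] /andP[ap pq] fpq.
  exists k, x, y; split => //.
  - by move=> i; have [? ? yp] := h1 i; split=> //; apply: le_trans yp pq.
  - exact: le_trans h3 (gmono _ _ pq).
  - have := ler_distD (f p) (f q) (f a); lra.
have good2 p q : good p -> a <= p <= q -> `[p, q] `<=` V -> good q.
  move=> [k [x [y [h1 h2 h3 h4]]]] /andP[ap pq] pqO.
  pose x' (i : 'I_k.+1) := if unlift ord0 i is Some j then x j else p.
  pose y' (i : 'I_k.+1) := if unlift ord0 i is Some j then y j else q.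
  exists k.+1, x', y'; split.
  - move=> i; rewrite /x' /y'; case: unliftP => [j|] _ //.
    by have [? ? yp] := h1 j; split=> //; apply: le_trans yp pq.
  - move=> i j; rewrite /x' /y'; case: unliftP => [i'|] ->; case: unliftP => [j'|] -> //.
    + rewrite (inj_eq lift_inj); exact: h2.
    + by move=> _; left; have [] := h1 i'.
    + by move=> _; right; have [] := h1 j'.
  - rewrite big_ord_recl.
    under eq_bigr do rewrite /x' /y' liftK.
    rewrite {1}/x' {1}/y' unlift_none.
    suff : ((q - p)%:E + g p <= g q)%E.
      move=> hh; have : fine ((q - p)%:E + g p)%E <= fine (g q).
        by apply: fine_le => //; rewrite fin_numD gfin.
      rewrite fineD//=; lra.
    (* The half-open interval is disjoint from [[a, p]], so its length adds to [g p]. *)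
    have -> : ((q - p)%:E = leb `]p, q])%E.
      rewrite lebesgue_measure_itv/= lte_fin; case: ltP => // qp.
      by rewrite (le_anti (introT andP (conj pq qp))) subrr.
    rewrite /g -measureU//; last first.
      apply/seteqP; split=> z //= [/=]; rewrite !in_itv/= => /andP[pz _] [_ /andP[_]].
      by rewrite leNgt pz.
      exact: mI.
    apply: lebesgue_measure_le => //; first by apply: measurableU => //; exact: mI.
    move=> z /= []; rewrite !in_itv/=.
      move=> /andP[pz zq]; split; last by rewrite zq andbT; apply: le_trans ap (ltW pz).
      by apply: pqO; rewrite /= in_itv/= zq andbT ltW.
    by move=> [? /andP[az zp]]; split=> //; rewrite az; exact: le_trans zp pq.
  - rewrite big_ord_recl.
    under eq_bigr do rewrite /x' /y' liftK.
    rewrite {1}/x' {1}/y' unlift_none.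
    have := ler_distD (f p) (f q) (f a).
    have : M * (p - a) <= M * (q - a) by apply: ler_wpM2l => //; lra.
    lra.
have gooda : good a.
  exists 0%N, (fun=> 0), (fun=> 0); split; rewrite ?big_ord0 ?subrr ?normr0 ?mulr0 ?addr0//.
  - by case.
  - by case.
  - by apply: fine_ge0; exact: measure_ge0.
pose E := [set z | a <= z <= b /\ good z].
have Ea : E a by split=> //; rewrite lexx.
have Esup : has_sup E by split; [exists a|exists b => z [/andP[]]].
pose c := sup E.
have ac : a <= c by exact: ub_le_sup (Esup.2) _ Ea.
have cb : c <= b by apply: ge_sup; [exists a|move=> z [/andP[]]].
(* Near the supremum [c], one move leads from a good point just below [c] to any point just above
   it, either through a ball inside [V] or by the derivative bound at [c]. *)
have step : exists2 e : R, 0 < e & forall p q, c - e < p -> p <= c -> c <= q -> q < c + e ->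
    a <= p -> good p -> good q.
  have [Oc|[e e0 he]] := H c (introT andP (conj ac cb)).
    move: oV; rewrite openE => /(_ _ Oc)/nbhs_ballP[e e0 he].
    exists e => // p q h1 h2 h3 h4 ap gp; apply: (good2 p) => //.
      by rewrite ap/=; exact: le_trans h3.
    move=> z /=; rewrite in_itv/= => /andP[pz zq]; apply: he.
    rewrite /ball/= ltr_norml; apply/andP; split; lra.
  exists e => // p q h1 h2 h3 h4 ap gp; apply: (good1 p) => //.
    by rewrite ap/=; exact: le_trans h3.
  have := he p; have := he q.
  rewrite (@ger0_norm _ (q - c)); last lra.
  rewrite (@ler0_norm _ (p - c)); last lra.
  move=> /(_ ltac:(lra)) u1 /(_ ltac:(lra)) u2.
  have := ler_distD (f c) (f q) (f p); rewrite (distrC (f c)); lra.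
have [e e0 he] := step.
have [p [/andP[ap pb] gp] cep] := sup_adherent e0 Esup.
have pc : p <= c by apply: ub_le_sup (Esup.2) _ _; split=> //; rewrite ap.
have gq q : c <= q -> q < c + e -> good q by move=> h1 h2; apply: (he p).
have cEb : c = b.
  apply/eqP; rewrite eq_le cb leNgt; apply/negP => cltb.
  pose q := Num.min b (c + e / 2).
  have cq : c < q by rewrite /q lt_min cltb ltrDl divr_gt0.
  suff : q <= c by rewrite leNgt cq.
  apply: ub_le_sup (Esup.2) _ _; split.
    by rewrite (le_trans ac (ltW cq))/= /q ge_min lexx.
  apply: gq; first exact: ltW.
  rewrite /q gt_min; apply/orP; right; lra.
have gb : good b by apply: gq; rewrite -cEb// ltrDl.
have [k [x [y [h1 h2 h3 h4]]]] := gb.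
exists k, x, y; split=> //; apply: le_trans h3 _.
apply: fine_le => //; first by rewrite ge0_fin_numE; [exact: Vfin|exact: measure_ge0].
by apply: lebesgue_measure_le => //; exact: subIsetl.
Qed.

(** The exceptional null set is enclosed in an open set so small that absolute continuity keeps the
    variation on its intervals below [e1]; elsewhere [open_cover_bound] gives growth at rate
    [M + e1]. *)
Lemma abs_cont_lipschitz f (I : set R) (a b M : R) (d : R -> R) :
  a <= b -> `[a, b] `<=` I -> abs_cont_on I f ->
  {ae leb, forall t, I t -> is_derive t (1:R) f (d t)} ->
  (forall t, I t -> `|d t| <= M) -> `|f b - f a| <= M * (b - a).
Proof.
move=> ab abI acf [N [mN N0 HN]] dM.
have M0 : 0 <= M by apply: le_trans (dM a _) => //; apply: abI; rewrite /= in_itv/= lexx.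
apply/ler_addgt0Pl => e e0.
(* Chosen so that [e1 * (b - a) + e1 = e]; the extra [e1] in the rate provides the strict inequality
   asked by [is_derive_near_bound]. *)
pose e1 := e / (1 + (b - a)).
have ba0 : 0 < 1 + (b - a) by lra.
have e10 : 0 < e1 by rewrite divr_gt0.
have [del [del0 hdel]] := acf e1 e10.
have [V [oV NO Odel]] : exists V : set R, [/\ open V, N `<=` V & (leb V < del%:E)%E].
  have [|V [oV NO Ole]] := lebesgue_regularity_outer mN _ del0; first by rewrite [X in (X < _)%E]N0.
  exists V; split => //.
  have mV : measurable V by exact: open_measurable.
  apply: le_lt_trans Ole; rewrite -[X in (_ <= X)%E]add0e -[X in (X + _)%E]N0 -measureU//.
  - by rewrite setDUK.
  - exact: measurableD.
  - by rewrite setDIK.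
have Vfin : (leb V < +oo)%E by apply: lt_trans Odel _; rewrite ltry.
have Me0 : 0 <= M + e1 by lra.
have [x xab|k [x [y [h1 h2 h3 h4]]]] := @open_cover_bound f a b (M + e1) V ab Me0 oV Vfin.
  have [Nx|nNx] := pselect (N x); first by left; exact: NO.
  right; have Ix : I x by apply: abI; rewrite /= in_itv/=.
  have dfx : is_derive x (1:R) f (d x).
    by apply: contrapT => ndf; apply: nNx; apply: HN => /(_ Ix).
  apply: is_derive_near_bound dfx _; apply: le_lt_trans (dM x Ix) _; lra.
have sdel : \sum_i (y i - x i) < del.
  apply: le_lt_trans h3 _; rewrite -lte_fin fineK//.
  by rewrite ge0_fin_numE; [exact: Vfin|exact: measure_ge0].
have h5 : \sum_i `|f (y i) - f (x i)| < e1.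
  apply: hdel h2 sdel => i; have [ax xy yb] := h1 i.
  by split; [|split=> //]; apply: abI; rewrite /= in_itv/=; apply/andP; split; lra.
have : e1 * (1 + (b - a)) = e by rewrite /e1 divfK// gt_eqF.
lra.
Qed.
End AbsCont.

(** * Borel maps on a measurable space *)

Section Borel.
Variable R : realType.
Context {d : measure_display} {X : measurableType d}.
Implicit Types (D : set X).

(** The target carries only a topology, as in [borel_fun]: the coefficients are Borel for the
    product topology on their arguments, and this notion composes with theirs. *)
Definition bmeas (Y : topologicalType) (D : set X) (f : X -> Y) : Prop :=
  forall B, borel_set B -> measurable (D `&` f @^-1` B).

Lemma bmeas_open (Y : topologicalType) D (f : X -> Y) : measurable D ->
  (forall B, open B -> measurable (D `&` f @^-1` B)) -> bmeas D f.
Proof.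
move=> mD mf B; apply: (smallest_sub _ mf).
split.
- by rewrite preimage_set0 setI0.
- move=> A mA; rewrite setTD preimage_setC -setDE.
  have -> : D `\` f @^-1` A = D `\` (D `&` f @^-1` A).
    by apply/seteqP; split=> x [Dx nA]; split=> //; [case|move=> Ax; exact: nA].
  exact: measurableD.
- move=> A mA; rewrite preimage_bigcup setI_bigcupr.
  by apply: bigcupT_measurable.
Qed.

(** Second countability of the factors makes the Borel sets of a product generated by rectangles,
    which is what [bmeas_pair] rests on. *)
Definition countable_base (Y : topologicalType) : Prop :=
  exists B : nat -> set Y, (forall k, open (B k)) /\
    forall y V, nbhs y V -> exists k, B k y /\ B k `<=` V.

Lemma countable_base_count (I : countType) (Y : topologicalType) (B : I -> set Y) :
  (forall k, open (B k)) ->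
  (forall y V, nbhs y V -> exists k, B k y /\ B k `<=` V) -> countable_base Y.
Proof.
move=> oB hB; exists (fun k => if unpickle k is Some i then B i else set0); split.
  by move=> k; case: unpickle => // ; exact: open0.
by move=> y V /hB[i hi]; exists (pickle i); rewrite pickleK.
Qed.

Lemma bmeas_base (Y : topologicalType) (I : countType) (B : I -> set Y) D (f : X -> Y) :
  measurable D ->
  (forall y V, nbhs y V -> exists k, B k y /\ B k `<=` V) ->
  (forall k, measurable (D `&` f @^-1` (B k))) -> bmeas D f.
Proof.
move=> mD hB mf; apply: bmeas_open => // V oV.
have -> : D `&` f @^-1` V =
    \bigcup_(k in [set k | B k `<=` V]) (D `&` f @^-1` B k).
  apply/seteqP; split=> x.
    move=> [Dx Vx]; have [k [Bk BV]] := hB (f x) V (open_nbhs_nbhs (conj oV Vx)).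
    by exists k.
  by move=> [k BV [Dx Bx]]; split=> //; exact: BV.
rewrite bigcup_mkcond; apply: countable_bigcupT_measurable => //.
by move=> k; case: ifPn.
Qed.

Lemma countable_base_R : countable_base R.
Proof.
apply: (@countable_base_count (rat * rat)%type R (fun q => `]ratr q.1, ratr q.2[%classic)).
  by move=> k; exact: interval_open.
move=> y V /nbhs_ballP[e /= e0 eV].
have [q1 /[!in_itv]/= /andP[a1 b1]] := @rat_in_itvoo R (y - e) y ltac:(lra).
have [q2 /[!in_itv]/= /andP[a2 b2]] := @rat_in_itvoo R y (y + e) ltac:(lra).
exists (q1, q2); split=> /=; first by rewrite in_itv/= b1 a2.
move=> z /=; rewrite in_itv/= => /andP[h1 h2]; apply: eV.
rewrite /ball/= ltr_norml; lra.
Qed.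

Definition rat_box m n (q : 'M[(rat * rat)%type]_(m, n)) : set 'M[R]_(m, n) :=
  [set M | forall i j, ratr (q i j).1 < M i j < ratr (q i j).2].

Lemma rat_box_base m n (M : 'M[R]_(m, n)) V :
  nbhs M V -> exists q, rat_box q M /\ rat_box q `<=` V.
Proof.
move=> /nbhs_ballP[e /= e0 eV].
have hq i j : exists q : (rat * rat)%type,
    ratr q.1 < M i j < ratr q.2 /\ M i j - e < ratr q.1 /\ ratr q.2 < M i j + e.
  have [q1 /[!in_itv]/= /andP[a1 b1]] := @rat_in_itvoo R (M i j - e) (M i j) ltac:(lra).
  have [q2 /[!in_itv]/= /andP[a2 b2]] := @rat_in_itvoo R (M i j) (M i j + e) ltac:(lra).
  by exists (q1, q2); split=> //=; rewrite b1 a2.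
have hq1 i : exists f : 'I_n -> (rat * rat)%type, forall j,
    ratr (f j).1 < M i j < ratr (f j).2 /\ M i j - e < ratr (f j).1 /\ ratr (f j).2 < M i j + e.
  by have [f hf] := choice (hq i); exists f.
have [q hq'] := choice hq1.
exists (\matrix_(i, j) q i j); split.
  by move=> i j; rewrite mxE; have [] := hq' i j.
move=> N hN; apply: eV; split=> // i j.
have := hN i j; rewrite mxE => /andP[h1 h2]; have [_ [h3 h4]] := hq' i j.
rewrite /ball/= ltr_norml; lra.
Qed.

Lemma countable_base_mx m n : countable_base 'M[R]_(m, n).
Proof.
apply: (@countable_base_count 'M[(rat * rat)%type]_(m, n) _ (@rat_box m n)); last exact: rat_box_base.
move=> q.
rewrite openE => M hM; exists (fun i j => `]ratr (q i j).1, ratr (q i j).2[%classic).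
  move=> i j; apply: open_nbhs_nbhs; split; first exact: interval_open.
  by rewrite /= in_itv/=; exact: hM.
by move=> N hN i j; have := hN i j; rewrite /= in_itv.
Qed.

Lemma countable_base_prod (Y Z : topologicalType) :
  countable_base Y -> countable_base Z -> countable_base (Y * Z)%type.
Proof.
move=> [B [oB hB]] [C [oC hC]].
apply: (@countable_base_count (nat * nat)%type _ (fun k => B k.1 `*` C k.2)).
  move=> k; rewrite openE => -[y z] [/= By Cz].
  by exists (B k.1, C k.2); [split=> /=; apply: open_nbhs_nbhs; split|].
move=> [y z] V [[V1 V2] [/= h1 h2] hV].
have [k1 [a1 b1]] := hB _ _ h1; have [k2 [a2 b2]] := hC _ _ h2.
exists (k1, k2); split=> // -[y' z'] [/= h3 h4]; apply: hV; split; [exact: b1|exact: b2].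
Qed.

Lemma borel_open (Y : topologicalType) (V : set Y) : open V -> borel_set V.
Proof. by move=> oV; exact: sub_sigma_algebra. Qed.

Lemma bmeas_pair (Y Z : topologicalType) D (f : X -> Y) (g : X -> Z) :
  countable_base Y -> countable_base Z -> measurable D ->
  bmeas D f -> bmeas D g -> bmeas D (fun x => (f x, g x)).
Proof.
move=> [B [oB hB]] [C [oC hC]] mD mf mg.
apply: (@bmeas_base _ (nat * nat)%type (fun k => B k.1 `*` C k.2)) => //.
  move=> [y z] V [[V1 V2] [/= h1 h2] hV].
  have [k1 [a1 b1]] := hB _ _ h1; have [k2 [a2 b2]] := hC _ _ h2.
  exists (k1, k2); split=> // -[y' z'] [/= h3 h4]; apply: hV; split; [exact: b1|exact: b2].
move=> k; have -> : D `&` (fun x => (f x, g x)) @^-1` (B k.1 `*` C k.2) =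
    (D `&` f @^-1` B k.1) `&` (D `&` g @^-1` C k.2).
  by apply/seteqP; split=> x /= [] => [Dx []|[? ?] []].
by apply: measurableI; [apply: mf|apply: mg]; apply: borel_open.
Qed.

Lemma borel_measurable_R (B : set R) : borel_set B -> measurable B.
Proof.
apply: smallest_sub => [|V oV]; last exact: open_measurable.
exact: sigma_algebra_measurable.
Qed.

Lemma bmeas_R D (f : X -> R) : measurable D -> measurable_fun D f -> bmeas D f.
Proof. by move=> mD mf B /borel_measurable_R mB; apply: mf. Qed.

Lemma bmeas_mx m n D (f : X -> 'M[R]_(m, n)) : measurable D ->
  (forall i j, measurable_fun D (fun x => f x i j)) -> bmeas D f.
Proof.
move=> mD mf; apply: (@bmeas_base _ 'M[(rat * rat)%type]_(m, n) (@rat_box m n)) => //.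
  exact: rat_box_base.
move=> q.
have -> : D `&` f @^-1` rat_box q = D `&` \bigcap_(i in [set: 'I_m]) \bigcap_(j in [set: 'I_n])
    (D `&` (fun x => f x i j) @^-1` `]ratr (q i j).1, ratr (q i j).2[).
  apply/seteqP; split=> x [Dx hM]; split=> //.
    by move=> i _ j _ /=; rewrite in_itv/=; split=> //; exact: hM.
  by move=> i j; have [] := hM i Logic.I j Logic.I; rewrite /= in_itv.
apply: measurableI => //; apply: fin_bigcap_measurable => // i _.
apply: fin_bigcap_measurable => // j _; exact: mf.
Qed.

Lemma bmeas_measurable D (f : X -> R) : measurable D -> bmeas D f -> measurable_fun D f.
Proof.
move=> mD mf; apply: (measurability _ (RGenOInfty.measurableE R)) => //.
move=> _ [_ [x ->] <-]; apply: mf; apply: borel_open; exact: interval_open.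
Qed.

Lemma bmeas_continuous (Y Z : topologicalType) D (f : X -> Y) (g : Y -> Z) :
  measurable D -> continuous g -> bmeas D f -> bmeas D (g \o f).
Proof.
move=> mD cg mf; apply: bmeas_open => // V oV; rewrite comp_preimage; apply: mf.
by apply: borel_open; apply: open_comp => // x _; exact: cg.
Qed.

Lemma bmeas_coord m n D (f : X -> 'M[R]_(m, n)) i j : measurable D ->
  bmeas D f -> measurable_fun D (fun x => f x i j).
Proof.
move=> mD mf; apply: bmeas_measurable => //.
by apply: (bmeas_continuous _ (@coord_continuous _ m n i j)).
Qed.

Lemma bmeas_borel_comp (Y Z : topologicalType) D (E : set Y) (f : X -> Y) (g : Y -> Z) :
  borel_fun E g -> bmeas D f -> (forall x, D x -> E (f x)) -> bmeas D (g \o f).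
Proof.
move=> mg mf DE B /mg[C [bC EC]].
suff -> : D `&` (g \o f) @^-1` B = D `&` f @^-1` C by exact: mf.
apply/seteqP; split=> x [Dx hx]; split=> //.
  have : (E `&` g @^-1` B) (f x) by split=> //; exact: DE.
  by rewrite EC => -[].
have : (E `&` C) (f x) by split=> //; exact: DE.
by rewrite -EC => -[].
Qed.

(** Serves for the two discrete quantities that select a formula: the number of shocks and the
    destination of a relocation. *)
Lemma measurable_fun_fin_case (F : finType) d' (Y : measurableType d') D (k : X -> F)
    (f : F -> X -> Y) :
  measurable D -> (forall a, measurable (D `&` [set x | k x = a])) ->
  (forall a, measurable_fun (D `&` [set x | k x = a]) (f a)) ->
  measurable_fun D (fun x => f (k x) x).
Proof.
move=> mD mk mf _ B mB.
have -> : D `&` (fun x => f (k x) x) @^-1` B =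
    \bigcup_(a in [set: F]) ((D `&` [set x | k x = a]) `&` f a @^-1` B).
  apply/seteqP; split=> x; first by move=> [Dx Bx]; exists (k x).
  by move=> [a _ [[Dx <-] Bx]].
apply: fin_bigcup_measurable => // a _; exact: mf.
Qed.

Lemma measurable_fun_sumr (I : Type) (r : seq I) (P : pred I) D (f : I -> X -> R) :
  (forall i, measurable_fun D (f i)) ->
  measurable_fun D (fun x => \sum_(i <- r | P i) f i x).
Proof.
move=> mf; elim: r => [|i r ih].
  by under eq_fun do rewrite big_nil; exact: measurable_cst.
under eq_fun do rewrite big_cons.
by case: (P i) => //; apply: measurable_funD.
Qed.

End Borel.

(** * Shock histories *)

Section Histories.
Variables (R : realType) (n : nat).
Implicit Types (u : 'rV[R]_n) (T t : R) (k : nat).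

(** Same content as [inU], with the number of shocks as a parameter instead of under an existential;
    [inU_history] identifies it with the cardinality [Zn u]. *)
Definition history T u k : Prop :=
  [/\ (k <= n)%N, forall i : 'I_n, (i < k)%N -> 0 <= u 0 i <= T,
      forall i j : 'I_n, (i <= j)%N -> (j < k)%N -> u 0 i <= u 0 j &
      forall i : 'I_n, (k <= i)%N -> u 0 i = -1].

Lemma card_ord_lt k : (k <= n)%N -> #|[pred i : 'I_n | (i < k)%N]| = k.
Proof.
move=> kn; rewrite -sum1_card /=.
under eq_bigl do rewrite inE.
by rewrite (big_ord_narrow kn) sum1_card card_ord.
Qed.

Lemma ge0_neqN1 (x : R) : 0 <= x -> x != -1.
Proof. by move=> x0; apply/eqP; lra. Qed.

Lemma Zn_eq u k : (k <= n)%N -> (forall i : 'I_n, (i < k)%N -> 0 <= u 0 i) ->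
  (forall i : 'I_n, (k <= i)%N -> u 0 i = -1) -> Zn u = k.
Proof.
move=> kn h1 h2; rewrite -[RHS](card_ord_lt kn); apply: eq_card => i; rewrite !inE.
by case: ltnP => [/h1/ge0_neqN1 ->//|/h2 ->]; rewrite eqxx.
Qed.

Lemma Zn_le u : (Zn u <= n)%N.
Proof. by rewrite -[X in (_ <= X)%N](card_ord n); exact: max_card. Qed.

Lemma val_Zo u : Zo u = Zn u :> nat.
Proof. by rewrite /Zo inordK// ltnS Zn_le. Qed.

Lemma history_inU T u k : history T u k -> inU T u /\ Zn u = k.
Proof.
move=> [kn h1 h2 h3]; split; last by apply: Zn_eq => // i /h1/andP[].
split; first by move=> i; case: (ltnP i k) => [/h1/andP[]|/h3]; [right|left].
by exists k; split=> //; split=> // i /h1/andP[].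
Qed.

Lemma inU_history T u : inU T u -> history T u (Zn u).
Proof.
move=> [h1 [k [kn [h2 [h3 h4]]]]]; rewrite (Zn_eq kn h2 h4).
split=> // i ik; rewrite h2//=; case: (h1 i) => [ui|[]//].
by have := h2 i ik; rewrite ui; lra.
Qed.

(* The time of the last shock, with the convention 0 before the first one; [tlast] is a
   junk value when no shock has occurred. *)
Definition tstart u : R := if Zn u == 0%N then 0 else tlast u.

Lemma tlastE u k (kn : (k < n)%N) : Zn u = k.+1 -> tlast u = u 0 (Ordinal kn).
Proof. by move=> zk; rewrite /tlast zk/= insubT. Qed.

Lemma tstart_itv T u : 0 <= T -> inU T u -> 0 <= tstart u <= T.
Proof.
move=> T0 /inU_history[]; rewrite /tstart; case zk : (Zn u) => [|k] kn h1 _ _ /=.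
  by rewrite lexx.
by rewrite (tlastE kn zk); exact: h1.
Qed.

Lemma le_tstart T u i : inU T u -> u 0 i <= tstart u.
Proof.
move=> /inU_history[]; rewrite /tstart; case zk : (Zn u) => [|k] kn h1 h2 h3 /=.
  by rewrite h3//; lra.
rewrite (tlastE kn zk); case: (leqP k.+1 i) => ik; last exact: h2.
by rewrite h3//; have /andP[] := h1 (Ordinal kn) (leqnn _); lra.
Qed.

(** The shock times are ordered, so the last one is their maximum: each section of [TS] is an
    interval, along which the differential equations can be integrated. *)
Lemma inTSP T t u : 0 <= T -> inU T u -> inTS T t u <-> tstart u <= t <= T.
Proof.
move=> T0 uU; have /andP[s0 sT] := tstart_itv T0 uU; split.
  move=> [t0 [tT [_ ut]]]; rewrite tT andbT /tstart.
  case zk : (Zn u) => [|k] //=; have kn : (k < n)%N by rewrite -zk Zn_le.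
  by rewrite (tlastE kn zk); exact: ut.
move=> /andP[st tT]; split; first exact: le_trans st.
by split=> //; split=> // i; apply: le_trans st; exact: (@le_tstart T).
Qed.

Lemma inTS_inU T t u : inTS T t u -> inU T u.
Proof. by move=> [_ [_ []]]. Qed.

Lemma inTS_time T t u : inTS T t u -> 0 <= t <= T.
Proof. by move=> [-> [->]]. Qed.

Lemma inTS_tstart T u : 0 <= T -> inU T u -> inTS T (tstart u) u.
Proof. by move=> T0 uU; apply/inTSP => //; rewrite lexx; have /andP[] := tstart_itv T0 uU. Qed.

Lemma inTS_end T u : 0 <= T -> inU T u -> inTS T T u.
Proof. by move=> T0 uU; apply/inTSP => //; rewrite lexx andbT; have /andP[] := tstart_itv T0 uU. Qed.

Lemma inTS_ushift T t u : inTS T t u -> (Zn u < n)%N ->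
  inTS T t (ushift u t) /\ Zn (ushift u t) = (Zn u).+1.
Proof.
move=> [t0 [tT [uU ut]]] zn; have [kn h1 h2 h3] := inU_history uU.
have [] : inU T (ushift u t) /\ Zn (ushift u t) = (Zn u).+1.
  apply: history_inU; split=> //.
  - move=> i; rewrite ltnS leq_eqVlt mxE => /orP[->|ik]; first by rewrite t0.
    by rewrite ltn_eqF//; exact: h1.
  - move=> i j ij; rewrite ltnS leq_eqVlt !mxE => /orP[/eqP jk|jk].
      by rewrite jk eqxx; case: eqP => // _; exact: ut.
    by rewrite (ltn_eqF jk) (ltn_eqF (leq_ltn_trans ij jk)); exact: h2.
  - by move=> i ik; rewrite mxE gtn_eqF//; apply: h3; exact: ltnW.
by move=> h4 h5; do 4?split=> //; move=> i; rewrite mxE; case: eqP.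
Qed.

Lemma history_uback T u k : inU T u -> Zn u = k.+1 -> history T (uback u) k.
Proof.
move=> /inU_history[+ + + +] zk; rewrite zk => kn h1 h2 h3; split=> //.
- exact: ltnW.
- by move=> i ik; rewrite mxE zk eqSS ltn_eqF//; apply: h1; exact: ltnW.
- move=> i j ij jk; rewrite !mxE zk !eqSS (ltn_eqF jk) (ltn_eqF (leq_ltn_trans ij jk)).
  by apply: h2 => //; exact: ltnW.
- move=> i ki; rewrite mxE zk eqSS; case: eqP => // /eqP ik; apply: h3.
  by rewrite ltn_neqAle eq_sym ik.
Qed.

Lemma inTS_uback T u : 0 <= T -> inU T u -> (1 <= Zn u)%N ->
  [/\ inTS T (tlast u) (uback u), (Zn (uback u)).+1 = Zn u & tstart u = tlast u].
Proof.
move=> T0 uU; rewrite /tstart; case zk : (Zn u) => [|k]//= _.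
have [h4 h5] := history_inU (history_uback uU zk); split; [|by rewrite h5|by []].
have [kn h1 h2 h3] := inU_history uU; rewrite zk in kn.
rewrite (tlastE kn zk); have /andP[u0 uT] := h1 (Ordinal kn) ltac:(by rewrite zk).
split=> //; split=> //; split=> // i; rewrite mxE zk eqSS; case: eqP => [_|/eqP ik]; first lra.
case: (ltnP i k) => ik'; first by apply: h2 => /=; [exact: ltnW|rewrite zk].
rewrite h3; first lra.
by rewrite zk ltn_neqAle eq_sym ik.
Qed.

Lemma inTS_u0 T : 0 <= T -> inTS T 0 (u0 R n) /\ Zn (u0 R n) = 0%N.
Proof.
move=> T0; have [h1 h2] : inU T (u0 R n) /\ Zn (u0 R n) = 0%N.
  by apply: history_inU; split=> // i *; rewrite mxE.
by split=> //; do 4?split=> //; move=> i; rewrite mxE; lra.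
Qed.

Lemma inU_u0 T u : inU T u -> Zn u = 0%N -> u = u0 R n.
Proof. by move=> /inU_history[_ _ _ h] z0; apply/rowP => i; rewrite mxE h// z0. Qed.

End Histories.

(** * Measurability of sets described by formulas *)

Section MeasurableSets.
Variables (R : realType) (d : measure_display) (X : measurableType d).
Implicit Types P Q : X -> Prop.

Definition mpred P : Prop := measurable [set x | P x].

Lemma mpred_and P Q : mpred P -> mpred Q -> mpred (fun x => P x /\ Q x).
Proof. exact: measurableI. Qed.

Lemma mpred_or P Q : mpred P -> mpred Q -> mpred (fun x => P x \/ Q x).
Proof. exact: measurableU. Qed.

Lemma mpred_imp (b : bool) P : mpred P -> mpred (fun x => b -> P x).
Proof.
move=> mP; case: b.
  by rewrite /mpred (_ : [set _ | _] = [set x | P x])//; apply/seteqP; split=> x //= ; apply.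
by rewrite /mpred (_ : [set _ | _] = setT)//; apply/seteqP; split.
Qed.

Lemma mpred_cst (P : Prop) : mpred (fun=> P).
Proof.
have [p|p] := pselect P.
  by rewrite /mpred (_ : [set _ | _] = setT)//; apply/seteqP; split.
by rewrite /mpred (_ : [set _ | _] = set0)//; apply/seteqP; split.
Qed.

Lemma mpred_forall (F : finType) (P : F -> X -> Prop) :
  (forall a, mpred (P a)) -> mpred (fun x => forall a, P a x).
Proof.
move=> mP; rewrite /mpred (_ : [set _ | _] = \bigcap_(a in [set: F]) [set x | P a x]).
  by apply: fin_bigcap_measurable => // a _; exact: mP.
by apply/seteqP; split=> x /= h a => [_|]; exact: h.
Qed.

Lemma mpred_exists (P : nat -> X -> Prop) :
  (forall a, mpred (P a)) -> mpred (fun x => exists a, P a x).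
Proof.
move=> mP; rewrite /mpred (_ : [set _ | _] = \bigcup_a [set x | P a x]).
  by apply: bigcupT_measurable.
by apply/seteqP; split=> x /= [a]; exists a.
Qed.

Lemma mpred_le (f g : X -> R) : measurable_fun setT f -> measurable_fun setT g ->
  mpred (fun x => f x <= g x).
Proof.
move=> mf mg; have := measurable_fun_ler mf mg => /(_ measurableT [set true]).
by rewrite setTI; apply.
Qed.

Lemma mpred_eq (f g : X -> R) : measurable_fun setT f -> measurable_fun setT g ->
  mpred (fun x => f x = g x).
Proof.
move=> mf mg; rewrite /mpred (_ : [set _ | _] = [set x | f x <= g x /\ g x <= f x]).
  by apply: mpred_and; exact: mpred_le.
apply/seteqP; split=> x /=; first by move=> ->.
by move=> [? ?]; apply/le_anti/andP.
Qed.
End MeasurableSets.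

(** * Measurability on the time-history space *)

Lemma measurable_fun_pairD d d1 d2 (X : measurableType d) (Y : measurableType d1)
    (Z : measurableType d2) (D : set X) (f : X -> Y) (g : X -> Z) :
  measurable_fun D f -> measurable_fun D g -> measurable_fun D (fun x => (f x, g x)).
Proof.
move=> mf mg mD; apply: (measurability _ (measurable_prod_measurableType Y Z)) => //.
move=> _ [_ [A mA [B mB <-]] <-].
rewrite (_ : _ `&` _ = (D `&` f @^-1` A) `&` (D `&` g @^-1` B)).
  by apply: measurableI; [exact: mf|exact: mg].
by apply/seteqP; split=> x /= [] => [Dx []|[? ?] []].
Qed.

Section TSMeasurable.
Variables (R : realType) (n : nat) (T : R).

Local Notation hist := (g_sigma_algebraType (@open 'rV[R]_n)).
Local Notation timed := (measurableTypeR R * hist)%type.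

Definition TS : set timed := [set p | inTS T p.1 p.2].

Lemma measurable_time (D : set timed) : measurable_fun D (fun p : timed => p.1 : R).
Proof. exact: measurable_funTS measurable_fst. Qed.

Lemma measurable_hist_coord (D : set timed) i :
  measurable_fun D (fun p : timed => (p.2 : 'rV[R]_n) 0 i).
Proof.
pose c (u : hist) : R := (u : 'rV[R]_n) 0 i.
have mc : measurable_fun [set: hist] c.
  by apply: (@bmeas_coord R _ hist 1 n setT id 0 i) => // B mB; rewrite setTI.
apply: measurable_funTS; exact: (measurableT_comp mc measurable_snd).
Qed.

Lemma measurable_to_hist d (X : measurableType d) (D : set X) (f : X -> 'rV[R]_n) :
  measurable D -> (forall i, measurable_fun D (fun x => f x 0 i)) ->
  measurable_fun D (f : X -> hist).
Proof.
move=> mD mf _; apply: bmeas_mx => // i j.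
by rewrite (ord1 i).
Qed.

Lemma measurable_TS : measurable TS.
Proof.
have mt := @measurable_time setT; have mc := @measurable_hist_coord setT.
have mcst (r : R) : measurable_fun [set: timed] (fun=> r) by exact: measurable_cst.
suff : mpred (fun p : timed => inTS T p.1 p.2) by [].
rewrite /inTS /inU; apply: mpred_and; first exact: (mpred_le (mcst _) mt).
apply: mpred_and; first exact: (mpred_le mt (mcst _)).
apply: mpred_and; last by apply: mpred_forall => i; exact: (mpred_le (mc _) mt).
apply: mpred_and.
  apply: mpred_forall => i; apply: mpred_or; first exact: (mpred_eq (mc _) (mcst _)).
  by apply: mpred_and; [exact: (mpred_le (mcst _) (mc _))|exact: (mpred_le (mc _) (mcst _))].
apply: mpred_exists => k; apply: mpred_and; first exact: mpred_cst.
apply: mpred_and.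
  by apply: mpred_forall => i; apply: mpred_imp; exact: (mpred_le (mcst _) (mc _)).
apply: mpred_and.
  by apply: mpred_forall => i; apply: mpred_forall => j; apply: mpred_imp; apply: mpred_imp;
    exact: (mpred_le (mc _) (mc _)).
by apply: mpred_forall => i; apply: mpred_imp; exact: (mpred_eq (mc _) (mcst _)).
Qed.

(** On [TS] the count of entries different from -1 amounts to sign conditions on the coordinates,
    each of which is measurable. *)
Lemma measurable_TS_Zo (a : 'I_n.+1) : measurable (TS `&` [set p | Zo (p.2 : 'rV[R]_n) = a]).
Proof.
have mc := @measurable_hist_coord setT.
have mcst (r : R) : measurable_fun [set: timed] (fun=> r) by exact: measurable_cst.
rewrite (_ : _ `&` _ = TS `&` [set p : timed |
   (forall i : 'I_n, (i < a)%N -> 0 <= (p.2 : 'rV[R]_n) 0 i) /\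
   (forall i : 'I_n, (a <= i)%N -> (p.2 : 'rV[R]_n) 0 i = -1)]).
  apply: measurableI; first exact: measurable_TS.
  suff : mpred (fun p : timed =>
      (forall i : 'I_n, (i < a)%N -> 0 <= (p.2 : 'rV[R]_n) 0 i) /\
      (forall i : 'I_n, (a <= i)%N -> (p.2 : 'rV[R]_n) 0 i = -1)) by [].
  apply: mpred_and; apply: mpred_forall => i; apply: mpred_imp.
    exact: (mpred_le (mcst _) (mc _)).
  exact: (mpred_eq (mc _) (mcst _)).
apply/seteqP; split=> p [TSp /= hp]; split=> //.
  have [_ h1 _ h2] := inU_history (inTS_inU TSp); rewrite -hp val_Zo.
  by split=> // i /h1/andP[].
by apply/val_inj => /=; rewrite val_Zo; apply: Zn_eq; [rewrite -ltnS| |]; case: hp.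
Qed.

Lemma measurable_TS_case d' (Y : measurableType d') (f : 'I_n.+1 -> timed -> Y) :
  (forall a, measurable_fun (TS `&` [set p | Zo (p.2 : 'rV[R]_n) = a]) (f a)) ->
  measurable_fun TS (fun p => f (Zo (p.2 : 'rV[R]_n)) p).
Proof.
move=> mf; apply: measurable_fun_fin_case => //; first exact: measurable_TS.
exact: measurable_TS_Zo.
Qed.

(** This map turns the diagonal term [v(t, (u, t))] into a composition. The replaced index depends
    on [u] only through its number of shocks, so each coordinate is treated case by case. *)
Lemma measurable_ushift :
  measurable_fun TS (fun p : timed => (p.1, ushift p.2 p.1) : timed).
Proof.
apply: measurable_fun_pairD; first exact: measurable_time.
apply: measurable_to_hist => [|i]; first exact: measurable_TS.
pose f := fun (a : 'I_n.+1) (p : timed) => if i == a :> nat then p.1 : R else (p.2 : 'rV[R]_n) 0 i.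
rewrite (_ : (fun _ => _) = fun p : timed => f (Zo (p.2 : 'rV[R]_n)) p).
  apply: (@measurable_TS_case _ _ f) => a; rewrite /f; case: eqP => _; first exact: measurable_time.
  exact: measurable_hist_coord.
by apply/funext => p /=; rewrite /f mxE val_Zo.
Qed.

Lemma measurable_tstart : measurable_fun TS (fun p : timed => tstart (p.2 : 'rV[R]_n)).
Proof.
pose f := fun (a : 'I_n.+1) (p : timed) => if a == 0 :> nat then 0 else
    if (insub a.-1 : option 'I_n) is Some k then (p.2 : 'rV[R]_n) 0 k else 0.
rewrite (_ : (fun _ => _) = fun p : timed => f (Zo (p.2 : 'rV[R]_n)) p).
  apply: (@measurable_TS_case _ _ f) => a; rewrite /f; case: eqP => _; first exact: measurable_cst.
  by case: insub => [k|]; [exact: measurable_hist_coord|exact: measurable_cst].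
by apply/funext => p /=; rewrite /f /tstart /tlast val_Zo.
Qed.

Lemma measurable_uback :
  measurable_fun TS (fun p : timed => (tstart (p.2 : 'rV[R]_n), uback p.2) : timed).
Proof.
apply: measurable_fun_pairD; first exact: measurable_tstart.
apply: measurable_to_hist => [|i]; first exact: measurable_TS.
pose f := fun (a : 'I_n.+1) (p : timed) => if i.+1 == a :> nat then -1 else (p.2 : 'rV[R]_n) 0 i.
rewrite (_ : (fun _ => _) = fun p : timed => f (Zo (p.2 : 'rV[R]_n)) p).
  apply: (@measurable_TS_case _ _ f) => a; rewrite /f; case: eqP => _; first exact: measurable_cst.
  exact: measurable_hist_coord.
by apply/funext => p /=; rewrite /f mxE val_Zo.
Qed.

Lemma measurable_at_time (s : timed -> R) : measurable_fun TS s ->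
  measurable_fun TS (fun p : timed => (s p, p.2) : timed).
Proof.
move=> ms; apply: measurable_fun_pairD => //.
exact: measurable_funTS measurable_snd.
Qed.

End TSMeasurable.

(** * Primitives depending on a history *)

Section Primitive.
Variables (R : realType) (n : nat) (T C : R).
Local Notation leb := (@lebesgue_measure R).
Local Notation hist := (g_sigma_algebraType (@open 'rV[R]_n)).
Local Notation timed := (measurableTypeR R * hist)%type.

(** The base point is minus infinity so that it does not move with the history; the integrands
    vanish outside [[0, T]], and constants of integration are adjusted afterwards. *)
Definition primitive (f : R -> R) (t : R) : R := \int[leb]_(s in `]-oo, t]) f s.

Section OneVariable.
Variable f : R -> R.
Hypotheses (mf : measurable_fun setT f) (fC : forall s, `|f s| <= C)
  (f0 : forall s, ~ (0 <= s <= T) -> f s = 0).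

Lemma bounded_integrable : leb.-integrable setT (EFin \o f).
Proof.
have h : leb.-integrable `[0, T] (EFin \o f).
  apply: measurable_bounded_integrable => //.
  - rewrite [X in (X < _)%E]lebesgue_measure_itv/=; case: ifPn => // _; by rewrite -EFinB ltry.
  - exact: measurable_funTS.
  - by exists C; split; [exact: num_real|move=> x Cx y _ /=; apply: le_trans (fC y) (ltW Cx)].
have := (integrable_mkcond (mu := leb) (EFin \o f) (measurable_itv `[0, T])).1 h.
rewrite (_ : _ \_ _ = EFin \o f)//.
apply/funext => s; rewrite /patch /=; case: ifPn => // /negP; rewrite inE/= in_itv/=.
by move=> /f0 ->.
Qed.

Let intf (A : set R) : measurable A -> leb.-integrable A (EFin \o f).
Proof. by move=> mA; apply: integrableS bounded_integrable. Qed.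

Lemma primitiveB s t : s <= t ->
  primitive f t - primitive f s = \int[leb]_(r in `]s, t]) f r.
Proof.
by move=> st; rewrite /primitive Rintegral_itvB ?bnd_simp//; exact: intf.
Qed.

Lemma primitive_lipschitz s t : s <= t -> `|primitive f t - primitive f s| <= C * (t - s).
Proof.
move=> st; rewrite primitiveB//.
apply: le_trans (le_normr_Rintegral _ (intf _)) _ => //.
have -> : C * (t - s) = \int[leb]_(r in `]s, t]) C.
  rewrite Rintegral_cst//= lebesgue_measure_itv/= lte_fin; case: ltP => //= ts.
  by rewrite (le_anti (introT andP (conj st ts))) subrr.
apply: le_Rintegral => //.
- by have := integrable_norm (intf (measurable_itv `]s, t])).
- apply: measurable_bounded_integrable => //.
  + rewrite [X in (X < _)%E]lebesgue_measure_itv/=; case: ifPn => // _; by rewrite -EFinB ltry.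
  + by exists `|C|; split; [exact: num_real|move=> x Cx y _ /=; exact: ltW].
Qed.

Lemma primitive_mono s t : (forall r, 0 <= f r) -> s <= t -> primitive f s <= primitive f t.
Proof. by move=> fge st; rewrite -subr_ge0 primitiveB//; apply: Rintegral_ge0. Qed.

Lemma primitive_derive :
  {ae leb, forall t, is_derive t (1 : R) (primitive f) (f t)}.
Proof.
have h1 : forall y, leb.-integrable `]-oo, y] (EFin \o f) by move=> y; exact: intf.
have h2 : locally_integrable [set: R] f.
  by apply: open_integrable_locally bounded_integrable; exact: openT.
have := FTC1Ny h1 h2.
apply: ae_impl => t [df ft]; apply: DeriveDef; first exact: df.
by rewrite -derive1E; exact: ft.
Qed.
End OneVariable.

Variable g : R -> 'rV[R]_n -> R.
Hypothesis C0 : 0 <= C.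
Hypothesis mg : measurable_fun (@TS R n T) (fun p : timed => g p.1 p.2).
Hypothesis gC : forall t u, inTS T t u -> `|g t u| <= C.

(** Extending by zero off [TS] makes every section a bounded integrable function on the whole line,
    while joint measurability is kept. *)
Let gx (u : 'rV[R]_n) (s : R) : R := if `[< inTS T s u >] then g s u else 0.

Let mgx : measurable_fun [set: timed] (fun p : timed => gx p.2 p.1).
Proof.
have := (measurable_restrictT _ (measurable_TS (n := n) T)).1 mg.
rewrite (_ : (fun _ => _) \_ _ = fun p : timed => gx p.2 p.1)//.
Qed.

Let mgx1 u : measurable_fun setT (gx u).
Proof.
have := measurableT_comp mgx (@measurable_fun_pair _ _ _ R (measurableTypeR R) hist id (cst u) (@measurable_id _ _ _) (@measurable_cst _ _ _ _ _ _)).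
exact.
Qed.

Let gxC u s : `|gx u s| <= C.
Proof. by rewrite /gx; case: asboolP => [/gC//|_]; rewrite normr0. Qed.

Let gx0 u s : ~ (0 <= s <= T) -> gx u s = 0.
Proof. by rewrite /gx; case: asboolP => // /inTS_time. Qed.

Lemma measurable_primitive :
  measurable_fun [set: timed] (fun p : timed => primitive (gx p.2) p.1).
Proof.
(* The moving upper bound of integration becomes an indicator, so that the integral over [s] has a
   fixed domain and [(t, u)] are parameters. *)
pose Kf (q : timed * measurableTypeR R) : R :=
  gx q.1.2 q.2 * (if (q.2 : R) <= (q.1.1 : R) then 1 else 0).
have mq1 : measurable_fun [set: timed * measurableTypeR R]
    (fun q : timed * measurableTypeR R => (q.2, q.1.2) : timed).
  apply: measurable_fun_pair; first exact: measurable_snd.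
  exact: (measurableT_comp measurable_snd measurable_fst).
have mK : measurable_fun setT Kf.
  apply: measurable_funM; first exact: (measurableT_comp mgx mq1).
  apply: measurable_fun_ifT; [|exact: measurable_cst|exact: measurable_cst].
  apply: measurable_fun_ler; first exact: measurable_snd.
  exact: (measurableT_comp measurable_fst measurable_fst).
have mKe : measurable_fun setT (EFin \o Kf) by exact/measurable_EFinP.
(* Tonelli concerns nonnegative integrands, hence the positive and negative parts are treated apart
   and subtracted. *)
have mP := measurable_fun_fubini_tonelli_F (m2 := leb) _
  (measurable_funepos mKe) (funepos_ge0 (EFin \o Kf)).
have mN := measurable_fun_fubini_tonelli_F (m2 := leb) _
  (measurable_funeneg mKe) (funeneg_ge0 (EFin \o Kf)).
have := measurableT_comp (fine_measurable measurableT) (emeasurable_funB mP mN).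
rewrite (_ : _ \o _ = fun p : timed => primitive (gx p.2) p.1)//.
apply/funext => -[t u] /=; rewrite /primitive Rintegral_mkcond /Rintegral.
rewrite [in RHS]integralE /fubini_F; congr (fine (_ - _)); apply: eq_integral => s _.
  rewrite !funeposE /Kf /= /patch; congr (Order.max _%:E _).
  have [st|st] := boolP (s <= t); first by rewrite mulr1 mem_set//= in_itv.
  by rewrite mulr0 memNset//= in_itv/=; exact/negP.
rewrite !funenegE /Kf /= /patch; congr (Order.max (- _%:E) _)%E.
have [st|st] := boolP (s <= t); first by rewrite mulr1 mem_set//= in_itv.
by rewrite mulr0 memNset//= in_itv/=; exact/negP.
Qed.

(** The four properties provide, in order, the measurability required by the next step, absolute
    continuity, the almost everywhere equation, and the sign of the distribution. *)
Lemma primitive_exists : exists P : R -> 'rV[R]_n -> R,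
  [/\ measurable_fun [set: timed] (fun p : timed => P p.1 p.2),
      forall u s t, s <= t -> `|P t u - P s u| <= C * (t - s),
      forall u, {ae leb, forall t, inTS T t u -> is_derive t (1 : R) (P^~ u) (g t u)} &
      forall u, (forall t, inTS T t u -> 0 <= g t u) ->
        forall s t, s <= t -> P s u <= P t u].
Proof.
exists (fun t u => primitive (gx u) t); split.
- exact: measurable_primitive.
- by move=> u s t; apply: primitive_lipschitz => //; exact: gx0.
- move=> u; have := primitive_derive (mgx1 u) (@gxC u) (@gx0 u).
  by apply: ae_impl => t; rewrite /gx; case: asboolP.
- move=> u gu s t; apply: primitive_mono => //; first exact: gx0.
  by move=> r; rewrite /gx; case: asboolP => // /gu.
Qed.

End Primitive.

Lemma lipschitz_abs_cont (R : realType) (I : set R) (f : R -> R) (C : R) : 0 <= C ->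
  (forall s t, I s -> I t -> s <= t -> `|f t - f s| <= C * (t - s)) -> abs_cont_on I f.
Proof.
move=> C0 fC e e0; exists (e / (C + 1)); split; first by rewrite divr_gt0//; lra.
move=> k x y hx _ hs; apply: (@le_lt_trans _ _ (\sum_i C * (y i - x i))).
  by apply: ler_sum => i _; have [Ix [Iy xy]] := hx i; exact: fC.
rewrite -mulr_sumr; move: hs; rewrite ltr_pdivlMr; last lra.
have : 0 <= \sum_i (y i - x i).
  by apply: sumr_ge0 => i _; have [_ [_ xy]] := hx i; rewrite subr_ge0.
lra.
Qed.

(** * Exponential weights and geometric limits *)

Section Analysis.
Variable R : realType.
Local Notation leb := (@lebesgue_measure R).

Lemma expRM_lipschitz (c T s t : R) : 0 <= s -> s <= t -> t <= T ->
  `|expR (c * t) - expR (c * s)| <= expR (`|c| * T) * `|c| * (t - s).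
Proof.
move=> s0 st tT.
have ub r : 0 <= r -> r <= T -> expR (c * r) <= expR (`|c| * T).
  move=> r0 rT; rewrite ler_expR; apply: (@le_trans _ _ (`|c| * r)).
    by apply: ler_wpM2r => //; exact: ler_norm.
  by apply: ler_wpM2l.
have lip (x y : R) : expR y - expR x <= expR y * (y - x).
  have := expR_ge1Dx (x - y); rewrite -(ler_pM2l (expR_gt0 y)) -expRD.
  by rewrite [y + _]addrC subrK; lra.
have cst : c * t - c * s <= `|c| * (t - s).
  by rewrite -mulrBr; apply: ler_wpM2r; [rewrite subr_ge0|exact: ler_norm].
have cts : c * s - c * t <= `|c| * (t - s).
  rewrite -opprB -mulrBr -mulNr; apply: ler_wpM2r; first by rewrite subr_ge0.
  by rewrite -normrN; exact: ler_norm.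
have c0 : 0 <= `|c| * (t - s) by rewrite mulr_ge0// subr_ge0.
have us := ub s s0 (le_trans st tT); have ut := ub t (le_trans s0 st) tT.
have key x y z : 0 <= x -> x <= expR (`|c| * T) -> y <= z -> 0 <= z ->
    x * y <= expR (`|c| * T) * z.
  move=> x0 xE yz z0; apply: (@le_trans _ _ (x * z)); first exact: ler_wpM2l.
  exact: ler_wpM2r.
rewrite -mulrA ler_norml; apply/andP; split.
  rewrite lerNl opprB; apply: le_trans (lip _ _) _; apply: key => //; exact: expR_ge0.
apply: le_trans (lip _ _) _; apply: key => //; exact: expR_ge0.
Qed.

Lemma abs_cont_expM (c T A : R) (I : set R) (f : R -> R) :
  I `<=` `[0, T] -> (forall t, I t -> `|f t| <= A) -> abs_cont_on I f ->
  abs_cont_on I (fun t => expR (c * t) * f t).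
Proof.
move=> IT fA acf e e0.
pose E := expR (`|c| * T); have E0 : 0 < E by exact: expR_gt0.
have [d1 [d10 hd1]] := acf (e / (2 * E)) ltac:(by rewrite divr_gt0// mulr_gt0).
(* [A] may be negative when [I] is empty, hence the absolute value. *)
pose M := E * `|c| * `|A|.
have M0 : 0 <= M by rewrite !mulr_ge0// ltW.
exists (Num.min d1 (e / (2 * (M + 1)))); split.
  by rewrite lt_min d10/= divr_gt0// mulr_gt0//; lra.
move=> k x y hxy disj; rewrite lt_min => /andP[s1 s2].
have bnd i : `|expR (c * y i) * f (y i) - expR (c * x i) * f (x i)| <=
    E * `|f (y i) - f (x i)| + M * (y i - x i).
  have [Ix [Iy xy]] := hxy i.
  have /= := IT _ Ix; rewrite in_itv/= => /andP[x0 xT].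
  have /= := IT _ Iy; rewrite in_itv/= => /andP[y0 yT].
  have -> : expR (c * y i) * f (y i) - expR (c * x i) * f (x i) =
     expR (c * y i) * (f (y i) - f (x i)) + (expR (c * y i) - expR (c * x i)) * f (x i) by lra.
  apply: le_trans (ler_normD _ _) _; rewrite !normrM; apply: lerD.
    apply: ler_wpM2r => //; rewrite ger0_norm ?expR_ge0// ler_expR.
    apply: (@le_trans _ _ (`|c| * y i)).
      by apply: ler_wpM2r => //; exact: ler_norm.
    by apply: ler_wpM2l.
  rewrite /M -mulrA [`|A| * _]mulrC mulrA; apply: ler_pM => //.
    exact: expRM_lipschitz.
  by apply: le_trans (fA _ Ix) _; exact: ler_norm.
apply: (@le_lt_trans _ _ (E * \sum_i `|f (y i) - f (x i)| + M * \sum_i (y i - x i))).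
  by rewrite !mulr_sumr -big_split/=; apply: ler_sum => i _; exact: bnd.
have h1 : E * \sum_i `|f (y i) - f (x i)| < e / 2.
  by have := hd1 k x y hxy disj s1; rewrite invfM mulrA ltr_pdivlMr// mulrC.
have h2 : M * \sum_i (y i - x i) <= e / 2.
  move: s2; rewrite invfM mulrA ltr_pdivlMr; last lra.
  have : 0 <= \sum_i (y i - x i).
    by apply: sumr_ge0 => i _; have [_ [_ xy]] := hxy i; rewrite subr_ge0.
  lra.
lra.
Qed.

Lemma is_derive_expM (c t : R) (f : R -> R) (df : R) : is_derive t (1 : R) f df ->
  is_derive t (1 : R) (fun s => expR (c * s) * f s) (expR (c * t) * (df + c * f t)).
Proof.
move=> hf.
have h1 : is_derive t (1 : R) (fun s : R => c * s) c.
  have := @is_deriveZ _ _ _ id c t 1 1 (is_derive_id _ _).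
  by rewrite [c *: 1]mulr1.
have h2 : is_derive t (1 : R) (fun s : R => expR (c * s)) (c * expR (c * t)).
  have := @is_derive1_comp _ expR (fun s : R => c * s) t _ _ (is_derive_expR _) h1.
  by rewrite mulrC.
apply: (is_derive_eq (is_deriveM h2 hf)); rewrite /GRing.scale/=; lra.
Qed.

Lemma is_derive_cstD (c t : R) (f : R -> R) df : is_derive t (1 : R) f df ->
  is_derive t (1 : R) (fun s => c + f s) df.
Proof.
move=> hf; have := is_deriveD (is_derive_cst c t (1 : R)) hf.
by move=> hd; apply: (is_derive_eq hd); rewrite add0r.
Qed.

Lemma ae_forall_fin (F : finType) (P : F -> R -> Prop) :
  (forall a, {ae leb, forall t, P a t}) -> {ae leb, forall t, forall a, P a t}.
Proof.
move=> h; apply: (@filter_forall R F P) => //; exact: (ae_filter_ringOfSetsType leb).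
Qed.

Lemma abs_contD (I : set R) (f g : R -> R) : abs_cont_on I f -> abs_cont_on I g ->
  abs_cont_on I (fun t => f t + g t).
Proof.
move=> acf acg e e0.
have [d1 [d10 h1]] := acf (e / 2) ltac:(lra).
have [d2 [d20 h2]] := acg (e / 2) ltac:(lra).
exists (Num.min d1 d2); split; first by rewrite lt_min d10.
move=> k x y hx hd; rewrite lt_min => /andP[s1 s2].
have := h1 _ _ _ hx hd s1; have := h2 _ _ _ hx hd s2.
suff : \sum_i `|f (y i) + g (y i) - (f (x i) + g (x i))| <=
  \sum_i `|f (y i) - f (x i)| + \sum_i `|g (y i) - g (x i)| by lra.
rewrite -big_split/=; apply: ler_sum => i _.
by rewrite opprD addrACA; exact: ler_normD.
Qed.

Lemma abs_contN (I : set R) (f : R -> R) : abs_cont_on I f ->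
  abs_cont_on I (fun t => - f t).
Proof.
move=> acf e e0; have [d [d0 hd]] := acf e e0; exists d; split=> // k x y hx hxy hs.
by under eq_bigr do rewrite -opprD normrN; exact: hd.
Qed.

Lemma abs_cont_cst (I : set R) (r : R) : abs_cont_on I (fun=> r).
Proof. by apply: (@lipschitz_abs_cont _ _ _ 0) => // s t _ _ _; rewrite subrr normr0 mul0r. Qed.

Lemma abs_cont_sum (F : finType) (I : set R) (f : F -> R -> R) :
  (forall i, abs_cont_on I (f i)) -> abs_cont_on I (fun t => \sum_i f i t).
Proof.
move=> acf; elim: (index_enum F) => [|i r ih].
  by under eq_fun do rewrite big_nil; exact: abs_cont_cst.
by under eq_fun do rewrite big_cons; exact: (abs_contD (acf i) ih).
Qed.

(** A move shorter than [d] changes [f] by less than one, and finitely many moves of length [d / 2]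
    cross the interval. *)
Lemma abs_cont_bounded (a b : R) (f : R -> R) : abs_cont_on `[a, b] f ->
  exists2 A : R, 0 <= A & forall t, a <= t <= b -> `|f t| <= A.
Proof.
move=> acf; have [d [d0 hd]] := acf 1 ltr01.
have close s t : a <= s -> s <= t -> t <= b -> t - s < d -> `|f t - f s| < 1.
  move=> sa st tb tsd; have := hd 1%N (fun=> s) (fun=> t); rewrite !big_ord1; apply=> //.
    by move=> i; rewrite /= !in_itv/= sa tb (le_trans sa st) (le_trans st tb).
  by move=> i j; rewrite (ord1 i) (ord1 j) eqxx.
have grow (k : nat) t : a <= t <= b -> t <= a + k%:R * (d / 2) -> `|f t| <= `|f a| + k%:R.
  elim: k t => [|k ih] t /andP[ta tb] tk.
    by rewrite (_ : t = a) ?addr0//; apply/le_anti; rewrite ta andbT; move: tk; rewrite mul0r addr0.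
  pose s := Num.max a (t - d / 2).
  have [sa st sd sk] : [/\ a <= s, s <= t, t - s < d & s <= a + k%:R * (d / 2)].
    move: tk; rewrite -natr1 mulrDl mul1r => tk; rewrite /s; case: (leP a (t - d / 2)) => h.
      by split=> //; lra.
    split=> //; first lra.
    by rewrite lerDl mulr_ge0//; lra.
  have := close s t sa st tb sd; have := ih s _ sk; rewrite sa (le_trans st tb) => /(_ isT).
  have := ler_normD (f t - f s) (f s); rewrite subrK -natr1; lra.
have [k hk] : exists k : nat, b - a <= k%:R * (d / 2).
  exists (Num.bound (`|b - a| / (d / 2))).
  rewrite -ler_pdivrMr; last lra.
  apply: le_trans (ltW (Num.Theory.archi_boundP _)); last by rewrite divr_ge0//; lra.
  by rewrite ler_pM2r ?invr_gt0; [exact: ler_norm|lra].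
exists (`|f a| + k%:R); first by rewrite addr_ge0.
by move=> t /andP[ta tb]; apply: grow; [rewrite ta|lra].
Qed.

(** Abstract contraction principle: [P e] reads as an error bound [e], and both uniqueness and the a
    priori bound on [v] come from improving such a bound by half. *)
Lemma halving (P : R -> Prop) (e0 : R) : 0 <= e0 -> P e0 ->
  (forall e, 0 <= e -> P e -> P (e / 2)) ->
  forall e, 0 < e -> exists2 e', 0 <= e' <= e & P e'.
Proof.
move=> e00 Pe0 hP e e1.
have hk k : P (e0 / 2 ^+ k).
  elim: k => [|k ih]; first by rewrite expr0 divr1.
  rewrite exprSr invfM mulrA; apply: hP => //.
  by rewrite divr_ge0// exprn_ge0.
have [k hke] : exists k : nat, e0 / 2 ^+ k <= e.
  have /Num.Theory.archi_boundP := divr_ge0 e00 (ltW e1).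
  set k := Num.bound _ => hk2; exists k.
  rewrite ler_pdivrMr ?exprn_gt0// mulrC -ler_pdivrMr//.
  apply: le_trans (ltW hk2) _.
  by rewrite -natrX ler_nat ltnW// ltn_expl.
by exists (e0 / 2 ^+ k) => //; rewrite hke divr_ge0// exprn_ge0.
Qed.

Lemma le_halving (x B : R) (P : R -> Prop) (e0 : R) : 0 <= e0 -> P e0 ->
  (forall e, 0 <= e -> P e -> P (e / 2)) -> (forall e, 0 <= e -> P e -> x <= B + e) ->
  x <= B.
Proof.
move=> e00 P0 hP hx; apply/ler_addgt0Pr => e egt0.
have [e' /andP[e'0 e'e] Pe'] := halving e00 P0 hP egt0.
by apply: le_trans (hx _ e'0 Pe') _; lra.
Qed.

Lemma pow2_le0 (x C : R) : 0 <= C -> (forall k : nat, x <= C / 2 ^+ k) -> x <= 0.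
Proof.
move=> C0 h; apply: (@le_halving x 0 (fun e => exists k : nat, e = C / 2 ^+ k) C) => //.
- by exists 0%N; rewrite expr0 divr1.
- by move=> e _ [k ->]; exists k.+1; rewrite exprSr invfM mulrA.
- by move=> e _ [k ->]; rewrite add0r.
Qed.

Lemma cvg_pow2 (C : R) : C / 2 ^+ k @[k --> \oo] --> (0 : R).
Proof.
have := @cvg_geometric R C (2^-1); rewrite ger0_norm// => /(_ ltac:(lra)).
by under eq_fun do rewrite /geometric/= -exprVn.
Qed.

(** With [r k = 2 * C / 2 ^ k], the sum of the remaining increments, [a - r] increases and [a + r]
    decreases; the limit lies between them, which gives convergence and rate at once. *)
Lemma geometric_limit (a : nat -> R) (C : R) : 0 <= C ->
  (forall k, `|a k - a k.+1| <= C / 2 ^+ k) ->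
  a @ \oo --> limn a /\ forall k, `|a k - limn a| <= 2 * C / 2 ^+ k.
Proof.
move=> C0 ha.
pose r (k : nat) : R := 2 * C / 2 ^+ k.
have rS k : r k = r k.+1 + C / 2 ^+ k.
  rewrite /r exprSr invfM; have := @pnatr_eq0 R 2; move: (2 ^+ k)^-1 => z _; lra.
have r0 k : 0 <= r k by rewrite divr_ge0// ?exprn_ge0// mulr_ge0.
have r_cvg : r k @[k --> \oo] --> (0 : R) by exact: cvg_pow2.
have nd : nondecreasing_seq (fun k => a k - r k).
  apply/nondecreasing_seqP => k; have := ha k; rewrite ler_norml => /andP[_]; rewrite rS; lra.
have ni : nonincreasing_seq (fun k => a k + r k).
  apply/nonincreasing_seqP => k; have := ha k; rewrite ler_norml => /andP[+ _]; rewrite (rS k); lra.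
have cv1 : cvgn (fun k => a k - r k).
  apply: nondecreasing_is_cvgn => //; exists (a 0%N + r 0%N) => _ [k _ <-].
  have := ni _ _ (leq0n k); have := r0 k; lra.
have acv : cvgn a.
  have -> : a = (fun k => (a k - r k) + r k) by apply/funext => k; rewrite subrK.
  by apply: is_cvgD => //; apply/cvg_ex; exists 0.
have l1 : (fun k => a k - r k) @ \oo --> limn a.
  by rewrite -[limn a]subr0; apply: cvgB.
have l2 : (fun k => a k + r k) @ \oo --> limn a.
  by rewrite -[limn a]addr0; apply: cvgD.
split=> // k.
have := nondecreasing_cvgn_le nd cv1 k; rewrite (cvg_lim _ l1)// => h1.
have := nonincreasing_cvgn_ge ni _ k; rewrite (cvg_lim _ l2)// => h2.
have {}h2 := h2 l2.
rewrite ler_norml -/(r k); apply/andP; split; lra.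
Qed.

End Analysis.

(** * The Picard scheme *)

Lemma ler_norm_dist (R : realType) (x y a b c : R) :
  `|y| <= a -> `|y - x| <= b -> a + b <= c -> `|x| <= c.
Proof.
move=> ya yxb abc; have := ler_normB y (y - x); rewrite subKr; lra.
Qed.

(** * The [l1] norm, the probability simplex and relocation matrices *)

Section Simplex.
Variables (R : realType) (S : nat).
Implicit Types (m x y : 'rV[R]_S).

Lemma ler_norm_sum_cst (f : 'I_S -> R) (c : R) : (forall j, `|f j| <= c) ->
  `|\sum_j f j| <= S%:R * c.
Proof.
move=> fc; apply: le_trans (ler_norm_sum _ _ _) _.
apply: (@le_trans _ _ (\sum_(j < S) c)); first by apply: ler_sum => j _.
by rewrite sumr_const card_ord mulr_natl.
Qed.

Lemma l1_ge0 x : 0 <= l1 x.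
Proof. by apply: sumr_ge0. Qed.

Lemma l1_coord x i : `|x 0 i| <= l1 x.
Proof. by rewrite /l1 (bigD1 i)//= lerDl; apply: sumr_ge0. Qed.

Lemma l1_le x (c : R) : (forall j, `|x 0 j| <= c) -> l1 x <= S%:R * c.
Proof.
move=> xc; apply: (@le_trans _ _ (\sum_(j < S) c)); first by apply: ler_sum => j _.
by rewrite sumr_const card_ord mulr_natl.
Qed.

Lemma l1_le_add x y (c : R) : (forall j, `|x 0 j| <= `|y 0 j| + c) -> l1 x <= l1 y + S%:R * c.
Proof.
move=> xc; apply: (@le_trans _ _ (\sum_(j < S) (`|y 0 j| + c))); first by apply: ler_sum => j _.
by rewrite big_split/= sumr_const card_ord mulr_natl.
Qed.

Lemma l1_inP m : inP m -> l1 m = 1.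
Proof. by move=> [m0 <-]; apply: eq_bigr => i _; rewrite ger0_norm. Qed.

Lemma l1B x y : l1 (x - y) <= l1 x + l1 y.
Proof.
by rewrite /l1 -big_split/=; apply: ler_sum => i _; rewrite !mxE; exact: ler_normB.
Qed.

Lemma l1_eq0 x y : l1 (x - y) <= 0 -> x = y.
Proof.
move=> h; apply/rowP => i; apply/eqP; rewrite -subr_eq0 -normr_le0.
by apply: le_trans h; have := l1_coord (x - y) i; rewrite !mxE.
Qed.

Definition relocation (f : 'I_S -> 'I_S) : 'M[R]_S := \matrix_(i, j) (f i == j)%:R.

Lemma relocation_row f i : \sum_j relocation f i j = 1.
Proof.
rewrite (bigD1 (f i))//= mxE eqxx big1 ?addr0// => j ji.
by rewrite mxE eq_sym (negbTE ji).
Qed.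

Lemma relocation_ge0 f i j : 0 <= relocation f i j.
Proof. by rewrite mxE. Qed.

Lemma l1_relocation f x : l1 (x *m relocation f) <= l1 x.
Proof.
apply: (@le_trans _ _ (\sum_j \sum_i `|x 0 i| * relocation f i j)).
  apply: ler_sum => j _; rewrite mxE; apply: le_trans (ler_norm_sum _ _ _) _.
  by apply: ler_sum => i _; rewrite normrM [`|relocation _ _ _|]ger0_norm// relocation_ge0.
rewrite exchange_big/=; apply: ler_sum => i _.
by rewrite -mulr_sumr relocation_row mulr1.
Qed.

Lemma inP_relocation f m : inP m -> inP (m *m relocation f).
Proof.
move=> [m0 m1]; split.
  by move=> j; rewrite mxE; apply: sumr_ge0 => i _; rewrite mulr_ge0// relocation_ge0.
under eq_bigr do rewrite mxE.
rewrite exchange_big/= -m1; apply: eq_bigr => i _.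
by rewrite -mulr_sumr relocation_row mulr1.
Qed.
End Simplex.

(** * Estimates on the right-hand sides, and solutions as fixed points *)

Section Scheme.
Variables (R : realType) (n S dA : nat) (T k0 L0 : R).
Variables (lam : R -> 'rV[R]_S -> 'rV[R]_n)
          (Q : R -> 'I_n.+1 -> 'rV[R]_S -> 'rV[R]_dA -> 'M[R]_S)
          (psi : R -> 'I_n.+1 -> 'rV[R]_S -> 'rV[R]_dA -> 'rV[R]_S)
          (Psi : 'I_n.+1 -> 'rV[R]_S -> 'rV[R]_S)
          (J : R -> 'I_S -> 'I_S)
          (h : R -> 'rV[R]_n -> 'rV[R]_S -> 'rV[R]_S -> 'M[R]_(S, dA))
          (m0 : 'rV[R]_S).
Local Notation leb := (@lebesgue_measure R).
Local Notation ph := (psihat psi h).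
Local Notation qh := (Qhat Q h).
Local Notation state := (R -> 'rV[R]_n -> 'rV[R]_S).

Hypotheses (Tgt0 : 0 < T) (k0ge0 : 0 <= k0) (L0ge0 : 0 <= L0).
Hypothesis qh_ge0 : forall t u m v, inTS T t u -> inP m -> forall i j, i != j ->
  0 <= qh t u m v i j.
Hypothesis qh_sum : forall t u m v, inTS T t u -> inP m -> forall i,
  \sum_j qh t u m v i j = 0.
Hypothesis qh_bound : forall t u m v, inTS T t u -> inP m -> forall i j,
  `|qh t u m v i j| <= k0.
Hypothesis ph_bound : forall t u m v, inTS T t u -> inP m -> forall i,
  `|ph t u m v i| <= k0.
Hypothesis lam_bound : forall t m, 0 <= t <= T -> inP m -> forall k, `|lam t m 0 k| <= k0.
Hypothesis Psi_bound : forall k m, inP m -> forall i, `|Psi k m 0 i| <= k0.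
Hypothesis ph_lip : forall t u, inTS T t u -> forall m m' v v', inP m -> inP m' ->
  forall i, `|ph t u m v i - ph t u m' v' i| <= L0 * (l1 (m - m') + l1 (v - v')).
Hypothesis qh_lip : forall t u, inTS T t u -> forall m m' v v', inP m -> inP m' ->
  forall i j, `|qh t u m v i j - qh t u m' v' i j| <= L0 * (l1 (m - m') + l1 (v - v')).
Hypothesis Psi_lip : forall k m m', inP m -> inP m' -> forall i,
  `|Psi k m 0 i - Psi k m' 0 i| <= L0 * l1 (m - m').
Hypothesis lam_lip : forall t, 0 <= t <= T -> forall m m', inP m -> inP m' -> forall k,
  `|lam t m 0 k - lam t m' 0 k| <= L0 * l1 (m - m').

Let T0 : 0 <= T. Proof. exact: ltW. Qed.

Implicit Types (mu v nu w : state) (t : R) (u : 'rV[R]_n).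

Definition simplex_valued mu : Prop := forall t u, inTS T t u -> inP (mu t u).

Definition bounded_by (B : R) v : Prop := forall t u i, inTS T t u -> `|v t u 0 i| <= B.

Local Notation rhsv := (rhs_v lam Q psi J h).
Local Notation rhsm := (rhs_mu Q h).

(** A distribution has total mass one, so averaging the intensities against it costs no factor [S];
    [rhs_mu_lip] gains from the same fact. *)
Lemma rhs_mu_bound mu v t u i : inTS T t u -> inP (mu t u) -> `|rhsm mu v t u i| <= k0.
Proof.
move=> tu Pm; rewrite /rhs_mu; apply: le_trans (ler_norm_sum _ _ _) _.
rewrite -[leRHS]mul1r -(l1_inP Pm) /l1 mulr_suml; apply: ler_sum => j _.
by rewrite normrM; apply: ler_wpM2l => //; exact: qh_bound.
Qed.

(* Adding [k0] to the diagonal makes the intensity matrix nonnegative. *)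
Lemma rhs_mu_ge mu v t u i : inTS T t u -> inP (mu t u) ->
  0 <= rhsm mu v t u i + k0 * mu t u 0 i.
Proof.
move=> tu Pm; rewrite /rhs_mu (bigD1 i)//=.
have h1 : 0 <= \sum_(j < S | j != i) mu t u 0 j * qh t u (mu t u) (v t u) j i.
  by apply: sumr_ge0 => j ji; rewrite mulr_ge0//; [exact: Pm.1|exact: qh_ge0].
have h2 : 0 <= mu t u 0 i * (k0 + qh t u (mu t u) (v t u) i i).
  rewrite mulr_ge0//; first exact: Pm.1.
  by have := qh_bound (v t u) tu Pm i i; rewrite ler_norml; lra.
lra.
Qed.

Lemma rhs_mu_sum mu v t u : inTS T t u -> inP (mu t u) -> \sum_i rhsm mu v t u i = 0.
Proof.
move=> tu Pm; rewrite /rhs_mu exchange_big/= big1// => j _.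
by rewrite -mulr_sumr qh_sum ?mulr0.
Qed.

Lemma rhs_mu_lip mu v mu' v' t u i (X Y : R) : inTS T t u ->
  inP (mu t u) -> inP (mu' t u) -> l1 (mu t u - mu' t u) <= X ->
  (forall j, `|v t u 0 j - v' t u 0 j| <= Y) ->
  `|rhsm mu v t u i - rhsm mu' v' t u i| <= k0 * X + L0 * (X + S%:R * Y).
Proof.
move=> tu Pm Pm' hX hY.
have hl1 : l1 (v t u - v' t u) <= S%:R * Y by apply: l1_le => j; rewrite !mxE.
rewrite /rhs_mu -sumrB.
apply: (@le_trans _ _ (\sum_j (`|(mu t u - mu' t u) 0 j| * k0 +
    `|mu' t u 0 j| * (L0 * (X + S%:R * Y))))).
  apply: le_trans (ler_norm_sum _ _ _) _; apply: ler_sum => j _.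
  set q := qh _ _ _ _ _ _; set q' := qh _ _ _ _ _ _.
  have -> : mu t u 0 j * q - mu' t u 0 j * q' =
      (mu t u - mu' t u) 0 j * q + mu' t u 0 j * (q - q') by rewrite !mxE; lra.
  apply: le_trans (ler_normD _ _) _; rewrite !normrM; apply: lerD.
    by apply: ler_wpM2l => //; exact: qh_bound.
  apply: ler_wpM2l => //; apply: le_trans (qh_lip tu _ _ Pm Pm' _ _) _.
  by apply: ler_wpM2l => //; exact: lerD.
rewrite big_split/= -!mulr_suml -/(l1 _) -/(l1 _) (l1_inP Pm') mul1r lerD2r mulrC.
exact: ler_wpM2l.
Qed.

(** The index of the next shock depends on [u] alone. Quantifying over the states inside the second
    alternative lets two states be compared at the same index. *)
Lemma jump_termP mu v t u i : inTS T t u ->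
  (jump_term lam J mu v t u i = 0 /\ Zn u = n) \/
  exists k : 'I_n, [/\ inTS T t (ushift u t), Zn (ushift u t) = (Zn u).+1 &
    forall mu' v', jump_term lam J mu' v' t u i =
    lam t (mu' t u) 0 k * (v' t (ushift u t) 0 (J t i) - v' t u 0 i)].
Proof.
move=> tu; rewrite /jump_term; case: insubP => [k kn ku|].
  by right; exists k; have [] := inTS_ushift tu kn.
rewrite -leqNgt => nu; left; split=> //; apply/eqP; rewrite eqn_leq nu andbT.
exact: Zn_le.
Qed.

(** Separate bounds along [u] and after the next shock: in the a priori estimate the latter is
    already sharp while the former is still being improved. *)
Lemma rhs_v_bound mu v t u i (B B' : R) : inTS T t u -> inP (mu t u) ->
  0 <= B -> 0 <= B' ->
  (forall j, `|v t u 0 j| <= B) ->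
  (inTS T t (ushift u t) -> (Zn (ushift u t) = (Zn u).+1) ->
     forall j, `|v t (ushift u t) 0 j| <= B') ->
  `|rhsv mu v t u i| <= k0 + S%:R * (k0 * B) + k0 * (B' + B).
Proof.
move=> tu Pm B0 B'0 hB hB'; rewrite /rhs_v.
apply: le_trans (ler_normB _ _) _; apply: lerD.
  apply: le_trans (ler_normB _ _) _; apply: lerD.
    by rewrite normrN; exact: ph_bound.
  by apply: ler_norm_sum_cst => j; rewrite normrM; apply: ler_pM => //; exact: qh_bound.
case: (jump_termP mu v i tu) => [[-> _]|[k [tu' zu ->]]].
  by rewrite normr0 mulr_ge0// addr_ge0.
rewrite normrM; apply: ler_pM => //; first by apply: lam_bound => //; exact: inTS_time tu.
by apply: le_trans (ler_normB _ _) _; apply: lerD => //; exact: hB'.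
Qed.

(** Differences of products are split so that the variation of a coefficient multiplies the values
    of [v], bounded by [B], and the variation of the values multiplies a coefficient bounded by
    [k0]. *)
Lemma rhs_v_lip mu v mu' v' t u i (X Y B : R) : inTS T t u ->
  inP (mu t u) -> inP (mu' t u) -> 0 <= B -> 0 <= Y ->
  bounded_by B v -> l1 (mu t u - mu' t u) <= X ->
  (forall u j, inTS T t u -> `|v t u 0 j - v' t u 0 j| <= Y) ->
  `|rhsv mu v t u i - rhsv mu' v' t u i| <=
    L0 * (X + S%:R * Y) + S%:R * (L0 * (X + S%:R * Y) * B + k0 * Y) +
    (L0 * X * (2 * B) + k0 * (2 * Y)).
Proof.
move=> tu Pm Pm' B0 Y0 hB hX hY.
have X0 : 0 <= X by apply: le_trans hX; exact: l1_ge0.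
have hl1 : l1 (v t u - v' t u) <= S%:R * Y by apply: l1_le => j; rewrite !mxE; exact: hY.
have hL : L0 * (l1 (mu t u - mu' t u) + l1 (v t u - v' t u)) <= L0 * (X + S%:R * Y).
  by apply: ler_wpM2l => //; exact: lerD.
rewrite /rhs_v.
set p := psihat _ _ _ _ _ _ _; set p' := psihat _ _ _ _ _ _ _.
set s := \sum_j _; set s' := \sum_j _; set j1 := jump_term _ _ _ _ _ _ _.
set j2 := jump_term _ _ _ _ _ _ _.
have -> : - p - s - j1 - (- p' - s' - j2) = - ((p - p') + (s - s') + (j1 - j2)) by lra.
rewrite normrN; apply: le_trans (ler_normD _ _) _; apply: lerD.
  apply: le_trans (ler_normD _ _) _; apply: lerD.
    by apply: le_trans hL; exact: ph_lip.
  rewrite /s /s' -sumrB; apply: ler_norm_sum_cst => j.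
  set q := qh _ _ _ _ _ _; set q' := qh _ _ _ _ _ _.
  have -> : q * v t u 0 j - q' * v' t u 0 j =
    (q - q') * v t u 0 j + q' * (v t u 0 j - v' t u 0 j) by lra.
  apply: le_trans (ler_normD _ _) _; rewrite !normrM; apply: lerD; apply: ler_pM => //.
  - by apply: le_trans hL; exact: qh_lip.
  - exact: hB.
  - exact: qh_bound.
  - exact: hY.
rewrite /j1 /j2; case: (jump_termP mu v i tu) => [[j0 zu]|[k [tu' zu hj]]].
  have -> : jump_term lam J mu' v' t u i = 0 by rewrite /jump_term insubN// zu ltnn.
  by rewrite j0 subrr normr0 addr_ge0// !mulr_ge0.
have tt := inTS_time tu; rewrite !hj.
set l := lam _ _ _ _; set l' := lam _ _ _ _; set a := v _ _ _ _; set b := v _ _ _ _.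
set a' := v' _ _ _ _; set b' := v' _ _ _ _.
have -> : l * (a - b) - l' * (a' - b') = (l - l') * (a - b) + l' * ((a - a') - (b - b')) by lra.
apply: le_trans (ler_normD _ _) _; rewrite !normrM; apply: lerD; apply: ler_pM => //.
- by apply: le_trans (lam_lip tt Pm Pm' k) _; exact: ler_wpM2l.
- by apply: le_trans (ler_normB _ _) _; rewrite mulr_natl mulr2n; apply: lerD; exact: hB.
- exact: lam_bound.
- by apply: le_trans (ler_normB _ _) _; rewrite mulr_natl mulr2n; apply: lerD; exact: hY.
Qed.

(* One explicit Picard step [(mu, v) -> (nu, w)]. The equation for [nu] is written for
   [exp(k0 t) nu]: its right-hand side is then nonnegative, so that the simplex is preserved. *)
Record is_step mu v nu w : Prop := IsStep {
  step_ac_mu : forall u i, inU T u ->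
    abs_cont_on [set t | inTS T t u] (fun t => expR (k0 * t) * nu t u 0 i);
  step_ac_v : forall u i, inU T u ->
    abs_cont_on [set t | inTS T t u] (fun t => w t u 0 i);
  step_mu : forall u i, inU T u -> {ae leb, forall t, inTS T t u ->
    is_derive t (1 : R) (fun s => expR (k0 * s) * nu s u 0 i)
      (expR (k0 * t) * (rhsm mu v t u i + k0 * mu t u 0 i))};
  step_v : forall u i, inU T u -> {ae leb, forall t, inTS T t u ->
    is_derive t (1 : R) (fun s => w s u 0 i) (rhsv mu v t u i)};
  step_end : forall u, inU T u -> w T u = Psi (Zo u) (mu T u);
  step_start : nu 0 (u0 R n) = m0;
  step_jump : forall u, inU T u -> (1 <= Zn u)%N ->
    nu (tlast u) u = mu (tlast u) (uback u) *m relocation R (J (tlast u)) }.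

Lemma inTS_sub_itv u : [set t | inTS T t u] `<=` `[0, T].
Proof. by move=> t /= /inTS_time; rewrite in_itv. Qed.

Lemma inTS_itv u s t : inTS T s u -> inTS T t u -> `[s, t] `<=` [set r | inTS T r u].
Proof.
move=> su tu r /=; have uU := inTS_inU su.
move: su tu => /(inTSP _ T0 uU)/andP[s1 s2] /(inTSP _ T0 uU)/andP[t1 t2].
rewrite in_itv/= => /andP[sr rt]; apply/inTSP => //.
by rewrite (le_trans s1 sr) (le_trans rt t2).
Qed.

Lemma solution_is_step mu v : is_solution T lam Q psi Psi J h mu v m0 -> is_step mu v mu v.
Proof.
move=> [Pmu [ac [dv [dmu [e3 [e4 e5]]]]]]; split=> //.
- move=> u i uU; apply: (@abs_cont_expM R k0 T 1); first exact: inTS_sub_itv.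
    by move=> t /Pmu/l1_inP <-; exact: l1_coord.
  exact: (ac u uU i).1.
- by move=> u i uU; exact: (ac u uU i).2.
- move=> u i uU; apply: ae_impl (dmu u uU i) => t dt tu.
  by apply: is_derive_expM; exact: dt.
- by move=> u i uU; exact: dv.
Qed.

(** The output of the step carries the regularity, hence is the solution; the input enters its
    equations only through values on [TS], including those at the shifted and at the preceding
    history. *)
Lemma step_solution mu v nu w : is_step mu v nu w -> simplex_valued nu ->
  (forall t u, inTS T t u -> mu t u = nu t u /\ v t u = w t u) ->
  is_solution T lam Q psi Psi J h nu w m0.
Proof.
move=> st Pnu eqs.
have eq_m t u i : inTS T t u -> rhsm mu v t u i = rhsm nu w t u i.
  by move=> tu; rewrite /rhs_mu; have [-> ->] := eqs _ _ tu.
have eq_v t u i : inTS T t u -> rhsv mu v t u i = rhsv nu w t u i.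
  move=> tu; rewrite /rhs_v.
  have -> : jump_term lam J mu v t u i = jump_term lam J nu w t u i.
    rewrite /jump_term; case: insubP => // k kn _.
    have [tu' _] := inTS_ushift tu kn.
    by have [-> ->] := eqs _ _ tu; have [_ ->] := eqs _ _ tu'.
  by have [-> ->] := eqs _ _ tu.
(* Multiplying by the inverse weight recovers both the absolute continuity of [nu] and its original
   equation. *)
have undo u i : (fun t => expR (- k0 * t) * (expR (k0 * t) * nu t u 0 i)) =
    (fun t => nu t u 0 i).
  by apply/funext => t; rewrite mulrA -expRD mulNr addNr expR0 mul1r.
split=> //; split.
  move=> u uU i; split; last exact: (step_ac_v st).
  rewrite -undo; apply: (@abs_cont_expM R (- k0) T (expR (k0 * T)) _ _ (@inTS_sub_itv u) _
    (step_ac_mu st i uU)) => t tu; rewrite normrM ger0_norm ?expR_ge0// -[leRHS]mulr1; apply: ler_pM => //.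
  - by rewrite ler_expR ler_wpM2l//; have /andP[] := inTS_time tu.
  - by rewrite -(l1_inP (Pnu _ _ tu)); exact: l1_coord.
split; first by move=> u uU i; apply: ae_impl (step_v st i uU) => t dt tu; rewrite -eq_v//; exact: dt.
split.
  move=> u uU i; apply: ae_impl (step_mu st i uU) => t dt tu.
  rewrite -undo; apply: (is_derive_eq (is_derive_expM (- k0) (dt tu))).
  have [<- _] := eqs _ _ tu; rewrite -eq_m//.
  rewrite [- k0 * (_ * _)]mulrCA -mulrDr mulrA -expRD mulNr addNr expR0 mul1r; lra.
split; first by move=> u uU; rewrite (step_end st uU); have [-> _] := eqs _ _ (inTS_end T0 uU).
split; first exact: (step_start st).
move=> u uU z1; rewrite (step_jump st uU z1).
by have [tu _ _] := inTS_uback T0 uU z1; have [-> _] := eqs _ _ tu.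
Qed.

(** * Smallness of the horizon, contraction and a priori bounds *)

Variables Bv wa wb : R.
(** [Bv] leaves room for a drift of one beyond the terminal bound [k0], [wa] dominates every weight
    [4 ^ Z(u)], and [wb] is such that the terminal error [L0 * (D * wa)] plus a drift [D / 4] stays
    below [(D / 2) * wb]. *)
Hypotheses (Bv_ge : k0 + 1 <= Bv) (wa_ge : 4 ^+ n <= wa) (wb_ge : 4 * L0 * wa + 1 <= wb).

(** Respective purposes: the exponential weight stays below [exp 1], the ball of radius [Bv] is
    preserved, an excess over [Bv] is halved, and the drifts of the two components are at most
    [D / 4]. *)
Hypothesis T_exp : k0 * T <= 1.
Hypothesis T_invariant : T * (k0 + S%:R * (k0 * Bv) + k0 * (Bv + Bv)) <= 1.
Hypothesis T_apriori : T * (S%:R * k0 + k0) <= 1 / 2.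
Hypothesis T_mu : T * (S%:R * (expR 1 * (k0 * wa + L0 * (wa + S%:R * wb) + k0 * wa))) <= 1 / 4.
Hypothesis T_v : T * (L0 * (wa + S%:R * wb) + S%:R * (L0 * (wa + S%:R * wb) * Bv + k0 * wb) +
    (L0 * wa * (2 * Bv) + k0 * (2 * wb))) <= 1 / 4.

Let wa_ge0 : 0 <= wa. Proof. by apply: le_trans wa_ge; exact: exprn_ge0. Qed.
Let wb_ge1 : 1 <= wb.
Proof. by apply: le_trans wb_ge; rewrite lerDr !mulr_ge0. Qed.
Let wb_ge0 : 0 <= wb. Proof. exact: le_trans wb_ge1. Qed.
Let wb_gt0 : 0 < wb. Proof. exact: lt_le_trans wb_ge1. Qed.
Let Bv_ge0 : 0 <= Bv. Proof. by apply: le_trans Bv_ge; rewrite addr_ge0. Qed.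

(* The weight [4 ^ Z(u)] absorbs the non-contracting transfer at the shock times, and the
   weight [wb] the non-contracting terminal condition. *)
Definition near_states (D : R) mu v mu' v' : Prop := forall t u, inTS T t u ->
  l1 (mu t u - mu' t u) <= D * 4 ^+ Zn u /\
  forall i, `|v t u 0 i - v' t u 0 i| <= D * wb.

Lemma near_states_max D mu v mu' v' t u : 0 <= D -> near_states D mu v mu' v' ->
  inTS T t u -> l1 (mu t u - mu' t u) <= D * wa.
Proof.
move=> D0 nr tu; have [h1 _] := nr _ _ tu; apply: le_trans h1 _.
apply: ler_wpM2l => //; apply: le_trans wa_ge.
by rewrite ler_weXn2l ?ler1n// Zn_le.
Qed.

(** Propagation along a fixed history since its last shock; the error present at that shock is kept
    as it is and is dealt with in [contraction]. *)
Lemma step_mu_contract mu v mu' v' nu w nu' w' D t u : 0 <= D ->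
  simplex_valued mu -> simplex_valued mu' ->
  is_step mu v nu w -> is_step mu' v' nu' w' -> near_states D mu v mu' v' ->
  inTS T t u ->
  l1 (nu t u - nu' t u) <= l1 (nu (tstart u) u - nu' (tstart u) u) + D / 4.
Proof.
move=> D0 Pm Pm' st st' nr tu; have uU := inTS_inU tu.
have tsu := inTS_tstart T0 uU; have /andP[s0 sT] := inTS_time tsu.
have /andP[t0 tT] := inTS_time tu.
have st_t : tstart u <= t by have /andP[] := (inTSP t T0 uU).1 tu.
pose M := k0 * (D * wa) + L0 * (D * wa + S%:R * (D * wb)) + k0 * (D * wa).
have M0 : 0 <= M by rewrite !addr_ge0 ?mulr_ge0// ?addr_ge0// ?mulr_ge0.
have E1 r : r <= T -> expR (k0 * r) <= expR 1.
  by move=> rT; rewrite ler_expR; apply: le_trans T_exp; apply: ler_wpM2l.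
have key i : `|nu t u 0 i - nu' t u 0 i| <=
    `|nu (tstart u) u 0 i - nu' (tstart u) u 0 i| + expR 1 * M * T.
  pose f r := expR (k0 * r) * nu r u 0 i - expR (k0 * r) * nu' r u 0 i.
  pose df r := expR (k0 * r) * (rhsm mu v r u i + k0 * mu r u 0 i) -
    expR (k0 * r) * (rhsm mu' v' r u i + k0 * mu' r u 0 i).
  have fle : `|f t - f (tstart u)| <= expR 1 * M * (t - tstart u).
    apply: (@abs_cont_lipschitz R f [set r | inTS T r u] _ _ _ df) => //.
    - exact: inTS_itv.
    - apply: (abs_contD (step_ac_mu st i uU)); apply: abs_contN; exact: (step_ac_mu st' i uU).
    - apply: ae_impl (ae_conj (step_mu st i uU) (step_mu st' i uU)) => r [d1 d2] ru.
      by apply: is_deriveB; [exact: d1|exact: d2].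
    - move=> r ru; rewrite /df -mulrBr normrM ger0_norm ?expR_ge0//.
      apply: ler_pM => //; first by apply: E1; have /andP[] := inTS_time ru.
      have -> : rhsm mu v r u i + k0 * mu r u 0 i - (rhsm mu' v' r u i + k0 * mu' r u 0 i) =
        (rhsm mu v r u i - rhsm mu' v' r u i) + k0 * (mu r u - mu' r u) 0 i by rewrite !mxE; lra.
      apply: le_trans (ler_normD _ _) _; apply: lerD.
        apply: rhs_mu_lip => //; [exact: Pm|exact: Pm'|exact: near_states_max nr ru|].
        by have [_] := nr _ _ ru.
      rewrite normrM (ger0_norm k0ge0); apply: ler_wpM2l => //.
      by apply: le_trans (l1_coord _ _) _; exact: near_states_max nr ru.
  have fle' : `|f t - f (tstart u)| <= expR 1 * M * T.
    apply: le_trans fle _; apply: ler_wpM2l; first by rewrite mulr_ge0// expR_ge0.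
    lra.
  have f_tri := ler_distD (f (tstart u)) (f t) 0; rewrite !subr0 in f_tri.
  move: f_tri; rewrite {1 4}/f -!mulrBr !normrM !(ger0_norm (expR_ge0 _)) => f_tri.
  move: (normr_ge0 (nu (tstart u) u 0 i - nu' (tstart u) u 0 i)) f_tri.
  move: (`|nu (tstart u) u 0 i - _|) (`|nu t u 0 i - _|) => y x y0 f_tri.
  have et1 : 1 <= expR (k0 * t) by rewrite -expR0 ler_expR mulr_ge0.
  (* The weight increases in time, so dividing by its value at [t] does not amplify the error
     present at [tstart u]. *)
  have est : expR (k0 * tstart u) <= expR (k0 * t) by rewrite ler_expR ler_wpM2l.
  have et0 := expR_gt0 (k0 * t).
  have h1 : expR (k0 * tstart u) * y <= expR (k0 * t) * y by apply: ler_wpM2r.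
  have Z0 : 0 <= expR 1 * M * T by rewrite !mulr_ge0// expR_ge0.
  have h2 : expR 1 * M * T <= expR (k0 * t) * (expR 1 * M * T) by rewrite ler_peMl.
  rewrite -(ler_pM2l et0) mulrDr; lra.
apply: (@le_trans _ _ (l1 (nu (tstart u) u - nu' (tstart u) u) + S%:R * (expR 1 * M * T))).
  by apply: l1_le_add => i; rewrite !mxE; exact: key.
rewrite lerD2l.
have -> : S%:R * (expR 1 * M * T) =
  D * (T * (S%:R * (expR 1 * (k0 * wa + L0 * (wa + S%:R * wb) + k0 * wa)))) by rewrite /M; lra.
by have := ler_wpM2l D0 T_mu; lra.
Qed.

Lemma contraction mu v mu' v' nu w nu' w' D : 0 <= D ->
  simplex_valued mu -> simplex_valued mu' -> bounded_by Bv v ->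
  is_step mu v nu w -> is_step mu' v' nu' w' -> near_states D mu v mu' v' ->
  near_states (D / 2) nu w nu' w'.
Proof.
move=> D0 Pm Pm' Bdv st st' nr t u tu; have uU := inTS_inU tu.
split.
  apply: le_trans (step_mu_contract D0 Pm Pm' st st' nr tu) _.
  have [z0|z1] := posnP (Zn u).
    rewrite /tstart z0 eqxx (inU_u0 uU z0) (step_start st) (step_start st') subrr.
    rewrite (_ : l1 0 = 0) ?expr0; first lra.
    by rewrite /l1 big1// => i _; rewrite mxE normr0.
  (* With [q] the weight before the shock, the inherited error [D * q] plus the drift [D / 4] is at
     most [2 * D * q], that is, [D / 2] times the new weight [4 * q]. *)
  have [tbu zb ->] := inTS_uback T0 uU z1.
  rewrite (step_jump st uU z1) (step_jump st' uU z1) -mulmxBl.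
  have [h1 _] := nr _ _ tbu.
  have := le_trans (l1_relocation (J (tlast u)) _) h1; rewrite -zb exprS.
  have : 1 <= 4 ^+ Zn (uback u) :> R by apply: exprn_ege1; rewrite ler1n.
  move: (4 ^+ _) => q q1; move: (l1 _) => x.
  have := ler_wpM2l D0 q1; lra.
move=> i; have /andP[t0 tT] := inTS_time tu.
pose M := L0 * (D * wa + S%:R * (D * wb)) +
   S%:R * (L0 * (D * wa + S%:R * (D * wb)) * Bv + k0 * (D * wb)) +
   (L0 * (D * wa) * (2 * Bv) + k0 * (2 * (D * wb))).
have B0 := Bv_ge0.
have Da : 0 <= D * wa by rewrite mulr_ge0.
have Db : 0 <= D * wb by rewrite mulr_ge0.
pose f r := w r u 0 i - w' r u 0 i.
have fle : `|f T - f t| <= M * (T - t).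
  apply: (@abs_cont_lipschitz R f [set r | inTS T r u] _ _ _
    (fun r => rhsv mu v r u i - rhsv mu' v' r u i)) => //.
  - by apply: inTS_itv => //; exact: inTS_end.
  - apply: (abs_contD (step_ac_v st i uU)); apply: abs_contN; exact: (step_ac_v st' i uU).
  - apply: ae_impl (ae_conj (step_v st i uU) (step_v st' i uU)) => r [d1 d2] ru.
    by apply: is_deriveB; [exact: d1|exact: d2].
  - move=> r ru; apply: rhs_v_lip => //; [exact: Pm|exact: Pm'|exact: near_states_max nr ru|].
    by move=> u' j ru'; have [_] := nr _ _ ru'.
have M0 : 0 <= M by rewrite !addr_ge0// !mulr_ge0// ?addr_ge0// ?mulr_ge0// ?addr_ge0// ?mulr_ge0.
have fle' : `|f T - f t| <= D / 4.
  apply: le_trans fle _; apply: (@le_trans _ _ (M * T)); first by apply: ler_wpM2l => //; lra.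
  have -> : M * T = D * (T * (L0 * (wa + S%:R * wb) + S%:R * (L0 * (wa + S%:R * wb) * Bv + k0 * wb) +
    (L0 * wa * (2 * Bv) + k0 * (2 * wb)))) by rewrite /M; lra.
  by have := ler_wpM2l D0 T_v; lra.
have fT : `|f T| <= L0 * (D * wa).
  rewrite /f (step_end st uU) (step_end st' uU).
  have Tu := inTS_end T0 uU.
  apply: le_trans (Psi_lip _ (Pm _ _ Tu) (Pm' _ _ Tu) _) _.
  by apply: ler_wpM2l => //; exact: near_states_max nr Tu.
apply: (ler_norm_dist fT fle'); have := ler_wpM2l D0 wb_ge; lra.
Qed.

Lemma step_bounded mu v nu w : simplex_valued mu -> bounded_by Bv v ->
  is_step mu v nu w -> bounded_by Bv w.
Proof.
move=> Pm Bdv st t u i tu; have uU := inTS_inU tu; have /andP[t0 tT] := inTS_time tu.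
have Tu := inTS_end T0 uU; have B0 := Bv_ge0.
pose M := k0 + S%:R * (k0 * Bv) + k0 * (Bv + Bv).
have M0 : 0 <= M by rewrite !addr_ge0 ?mulr_ge0// ?mulr_ge0// ?addr_ge0.
have fle : `|w T u 0 i - w t u 0 i| <= M * (T - t).
  apply: (@abs_cont_lipschitz R (fun r => w r u 0 i) [set r | inTS T r u] _ _ _
    (fun r => rhsv mu v r u i)) => //.
  - exact: inTS_itv.
  - exact: (step_ac_v st i uU).
  - exact: (step_v st i uU).
  - by move=> r ru; apply: rhs_v_bound => //; [exact: Pm| |] => [j|ru' _ j]; exact: Bdv.
have fle' : M * (T - t) <= 1.
  by apply: le_trans T_invariant; rewrite mulrC; apply: ler_wpM2r => //; lra.
have wT : `|w T u 0 i| <= k0 by rewrite (step_end st uU); exact/Psi_bound/Pm.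
by apply: (ler_norm_dist wT (le_trans fle fle')).
Qed.

(** Induction on the number of shocks left: values after the next shock are bounded by [Bv], and
    along [u] itself absolute continuity gives some bound [Bv + e], whose excess [e] the equation
    halves until it vanishes. *)
Lemma fixpoint_bounded mu v : simplex_valued mu -> is_step mu v mu v -> bounded_by Bv v.
Proof.
move=> Pm st; have B0 := Bv_ge0.
suff main : forall k u, inU T u -> (n - Zn u)%N = k ->
    forall t i, inTS T t u -> `|v t u 0 i| <= Bv.
  by move=> t u i tu; exact: (main _ u (inTS_inU tu) erefl).
elim/ltn_ind => k ih u uU zu.
have shiftB t : inTS T t (ushift u t) -> Zn (ushift u t) = (Zn u).+1 ->
    forall j, `|v t (ushift u t) 0 j| <= Bv.
  move=> ts zs j; apply: (ih (n - Zn (ushift u t))%N) => //; last exact: inTS_inU ts.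
  by have := Zn_le (ushift u t); rewrite zs -zu => zn; rewrite ltn_sub2l.
have itvE : [set t | inTS T t u] = `[tstart u, T]%classic.
  apply/seteqP; split=> t /=; first by move=> /(inTSP t T0 uU); rewrite in_itv.
  by rewrite in_itv/= => ?; exact/inTSP.
have [A A0 hA] : exists2 A : R, 0 <= A & forall i t, inTS T t u -> `|v t u 0 i| <= A.
  have hi i : exists A : R, 0 <= A /\ forall t, inTS T t u -> `|v t u 0 i| <= A.
    have := step_ac_v st i uU; rewrite itvE => /abs_cont_bounded[A A0 hA].
    by exists A; split=> // t /(inTSP t T0 uU); exact: hA.
  have [A hA] := choice hi.
  exists (\sum_i A i); first by apply: sumr_ge0 => i _; have [] := hA i.
  move=> i t tu; have [_ hAi] := hA i; apply: le_trans (hAi t tu) _.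
  by rewrite (bigD1 i)//= lerDl; apply: sumr_ge0 => j _; have [] := hA j.
pose P e := forall t i, inTS T t u -> `|v t u 0 i| <= Bv + e.
have PA : P A by move=> t i tu; apply: le_trans (hA i t tu) _; lra.
have Phalf e : 0 <= e -> P e -> P (e / 2).
  move=> e0 Pe t i tu; have /andP[t0 tT] := inTS_time tu; have Tu := inTS_end T0 uU.
  pose M := k0 + S%:R * (k0 * (Bv + e)) + k0 * (Bv + (Bv + e)).
  have M0 : 0 <= M by rewrite !addr_ge0 ?mulr_ge0// ?mulr_ge0// ?addr_ge0// addr_ge0.
  have fle : `|v T u 0 i - v t u 0 i| <= M * (T - t).
    apply: (@abs_cont_lipschitz R (fun r => v r u 0 i) [set r | inTS T r u] _ _ _
      (fun r => rhsv mu v r u i)) => //.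
    - exact: inTS_itv.
    - exact: (step_ac_v st i uU).
    - exact: (step_v st i uU).
    - move=> r ru; apply: rhs_v_bound => //; [exact: Pm|lra|by move=> j; exact: Pe|].
      exact: shiftB.
  have fle' : M * (T - t) <= 1 + e / 2.
    apply: (@le_trans _ _ (M * T)); first by apply: ler_wpM2l => //; lra.
    have -> : M * T = T * (k0 + S%:R * (k0 * Bv) + k0 * (Bv + Bv)) +
      e * (T * (S%:R * k0 + k0)) by rewrite /M; lra.
    have := ler_wpM2l e0 T_apriori; have := T_invariant; lra.
  have vT : `|v T u 0 i| <= k0 by rewrite (step_end st uU); exact/Psi_bound/Pm.
  by apply: (ler_norm_dist vT (le_trans fle fle')); rewrite addrA lerD2r.
move=> t i tu; apply: (le_halving A0 PA Phalf) => e _ Pe; exact: Pe.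
Qed.

Lemma near_states_eq mu v mu' v' (D : R) : 0 <= D -> near_states D mu v mu' v' ->
  (forall e, 0 <= e -> near_states e mu v mu' v' -> near_states (e / 2) mu v mu' v') ->
  forall t u, inTS T t u -> mu t u = mu' t u /\ v t u = v' t u.
Proof.
move=> D0 nD half t u tu; split.
  apply: l1_eq0; have q0 : 0 < 4 ^+ Zn u :> R by exact: exprn_gt0.
  suff : l1 (mu t u - mu' t u) / 4 ^+ Zn u <= 0 by rewrite pmulr_lle0// invr_gt0.
  apply: (le_halving D0 nD half) => e _ ne; rewrite add0r ler_pdivrMr//.
  by have [] := ne _ _ tu.
apply/rowP => i; apply/eqP; rewrite -subr_eq0 -normr_le0.
suff : `|v t u 0 i - v' t u 0 i| / wb <= 0 by rewrite pmulr_lle0// invr_gt0.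
apply: (le_halving D0 nD half) => e _ ne; rewrite add0r ler_pdivrMr//.
by have [_] := ne _ _ tu.
Qed.

(** The radius [2 * Bv] also covers the distributions: two of them are at [l1] distance at most 2,
    and [1 <= Bv]. *)
Lemma near_states_init mu v mu' v' : simplex_valued mu -> simplex_valued mu' ->
  bounded_by Bv v -> bounded_by Bv v' -> near_states (2 * Bv) mu v mu' v'.
Proof.
move=> Pm Pm' Bd Bd' t u tu; split.
  apply: le_trans (l1B _ _) _; rewrite !l1_inP; [|exact: Pm'|exact: Pm].
  have : 1 <= 4 ^+ Zn u :> R by apply: exprn_ege1; rewrite ler1n.
  move: (4 ^+ _) => q q1; have B1 : 1 <= Bv by apply: le_trans Bv_ge; rewrite lerDr.
  by rewrite -mulrA mulr_natl mulr2n; apply: lerD; rewrite mulr_ege1.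
move=> i; apply: le_trans (ler_normB _ _) _.
rewrite -mulrA mulr_natl mulr2n.
by apply: lerD; [apply: le_trans (Bd _ _ i tu) _|apply: le_trans (Bd' _ _ i tu) _];
  rewrite ler_peMr.
Qed.

Lemma fixpoint_unique mu v mu' v' : simplex_valued mu -> simplex_valued mu' ->
  is_step mu v mu v -> is_step mu' v' mu' v' ->
  forall t u, inTS T t u -> mu t u = mu' t u /\ v t u = v' t u.
Proof.
move=> Pm Pm' st st'.
have Bd := fixpoint_bounded Pm st; have Bd' := fixpoint_bounded Pm' st'.
apply: (near_states_eq _ (near_states_init Pm Pm' Bd Bd')); first by rewrite mulr_ge0.
by move=> e e0 ne; apply: (contraction e0 Pm Pm' Bd st st').
Qed.

(** * Measurable states, construction of a step, and convergence of the iterates *)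

Local Notation hist := (g_sigma_algebraType (@open 'rV[R]_n)).
Local Notation timed := (measurableTypeR R * hist)%type.
Local Notation TSs := (@TS R n T).

Definition jmeas (f : state) : Prop :=
  forall i, measurable_fun TSs (fun p : timed => f p.1 p.2 0 i).

Hypothesis meas_ph : forall mu v, simplex_valued mu -> jmeas mu -> jmeas v ->
  forall i, measurable_fun TSs (fun p : timed => ph p.1 p.2 (mu p.1 p.2) (v p.1 p.2) i).
Hypothesis meas_qh : forall mu v, simplex_valued mu -> jmeas mu -> jmeas v ->
  forall i j, measurable_fun TSs (fun p : timed => qh p.1 p.2 (mu p.1 p.2) (v p.1 p.2) i j).
Hypothesis meas_lam : forall mu, simplex_valued mu -> jmeas mu ->
  forall k, measurable_fun TSs (fun p : timed => lam p.1 (mu p.1 p.2) 0 k).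
Hypothesis meas_Psi : forall mu, simplex_valued mu -> jmeas mu ->
  forall i, measurable_fun TSs (fun p : timed => Psi (Zo (p.2 : 'rV[R]_n)) (mu T p.2) 0 i).
(** The time is an arbitrary measurable function because relocation is evaluated both at the current
    time, in the jump term, and at the last shock, in the initial value. *)
Hypothesis meas_J : forall (s : timed -> R), measurable_fun TSs s ->
  (forall p, TSs p -> 0 <= s p <= T) ->
  forall i j, measurable (TSs `&` [set p | J (s p) i = j]).
Hypothesis m0P : inP m0.

Let mTS : measurable TSs. Proof. exact: measurable_TS. Qed.

Lemma measurable_jump mu v i : simplex_valued mu -> jmeas mu -> jmeas v ->
  measurable_fun TSs (fun p : timed => jump_term lam J mu v p.1 p.2 i).
Proof.
move=> Pm mm mv.
pose f (a : 'I_n.+1) (p : timed) : R := if (insub (a : nat) : option 'I_n) is Some k then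
  lam p.1 (mu p.1 p.2) 0 k * (v p.1 (ushift p.2 p.1) 0 (J p.1 i) - v p.1 p.2 0 i) else 0.
rewrite (_ : (fun _ => _) = fun p : timed => f (Zo (p.2 : 'rV[R]_n)) p); last first.
  by apply/funext => p; rewrite /jump_term /f val_Zo.
apply: (@measurable_TS_case R n T _ _ f) => a; rewrite /f.
have mD := @measurable_TS_Zo R n T a.
set D := (X in measurable_fun X _).
have DTS : D `<=` TSs by exact: subIsetl.
have mS g : measurable_fun TSs g -> measurable_fun D (g : timed -> R).
  by move=> mg; apply: measurable_funS mg.
case: insubP => [k kn ka|_]; last exact: measurable_cst.
apply: measurable_funM; first by apply: mS; exact: (meas_lam Pm mm k).
apply: measurable_funB; last by apply: mS; exact: (mv i).
(* The state reached after the shock takes finitely many values; each is treated on its own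
   measurable piece, where the term is [v] composed with the diagonal map. *)
pose g (j : 'I_S) (p : timed) : R := v p.1 (ushift p.2 p.1) 0 j.
apply: (@measurable_fun_fin_case _ _ _ _ _ D (fun p : timed => J p.1 i) g) => //.
  move=> j; rewrite -(setIidl DTS) -setIA; apply: measurableI => //.
  apply: (@meas_J (fun p : timed => p.1)); first exact: measurable_time.
  by move=> p; exact: inTS_time.
move=> j; apply: (measurable_funS mD (@subIsetl _ _ _)).
apply: (@measurable_comp _ _ _ _ _ _ TSs (fun p : timed => v p.1 p.2 0 j) D
  (fun p : timed => (p.1, ushift p.2 p.1) : timed)) => //.
- move=> _ [p [TSp /= zp] <-]; have [] := inTS_ushift TSp _ => //.
  by rewrite -val_Zo zp.
- by apply: measurable_funS (@measurable_ushift R n T).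
Qed.

Lemma measurable_rhs_v mu v i : simplex_valued mu -> jmeas mu -> jmeas v ->
  measurable_fun TSs (fun p : timed => rhsv mu v p.1 p.2 i).
Proof.
move=> Pm mm mv; apply: measurable_funB; last exact: measurable_jump.
apply: measurable_funB; first by apply: measurable_funN; exact: meas_ph.
by apply: measurable_fun_sumr => j; apply: measurable_funM; [exact: meas_qh|exact: mv].
Qed.

Lemma measurable_rhs_mu mu v i : simplex_valued mu -> jmeas mu -> jmeas v ->
  measurable_fun TSs (fun p : timed => expR (k0 * p.1) *
    (rhsm mu v p.1 p.2 i + k0 * mu p.1 p.2 0 i)).
Proof.
move=> Pm mm mv; apply: measurable_funM.
  apply: (measurableT_comp (@measurable_expR R)); apply: measurable_funM.
    exact: measurable_cst.
  exact: measurable_time.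
apply: measurable_funD; last by apply: measurable_funM; [exact: measurable_cst|exact: mm].
by apply: measurable_fun_sumr => j; apply: measurable_funM; [exact: mm|exact: meas_qh].
Qed.

Definition initial mu u : 'rV[R]_S := if Zn u == 0%N then m0 else
  mu (tlast u) (uback u) *m relocation R (J (tlast u)).

Lemma initial_inP mu u : simplex_valued mu -> inU T u -> inP (initial mu u).
Proof.
move=> Pm uU; rewrite /initial; case: eqP => [//|/eqP]; rewrite -lt0n => z1.
by apply: inP_relocation; apply: Pm; have [] := inTS_uback T0 uU z1.
Qed.

Lemma measurable_initial mu i : simplex_valued mu -> jmeas mu ->
  measurable_fun TSs (fun p : timed => initial mu p.2 0 i).
Proof.
move=> Pm mm.
pose f (a : 'I_n.+1) (p : timed) : R := if (a : nat) == 0%N then m0 0 i else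
  \sum_j mu (tlast (p.2 : 'rV[R]_n)) (uback p.2) 0 j *
    (J (tlast (p.2 : 'rV[R]_n)) j == i)%:R.
rewrite (_ : (fun _ => _) = fun p : timed => f (Zo (p.2 : 'rV[R]_n)) p); last first.
  apply/funext => p; rewrite /initial /f val_Zo; case: eqP => // _.
  by rewrite mxE; apply: eq_bigr => j _; rewrite mxE.
apply: (@measurable_TS_case R n T _ _ f) => a; rewrite /f.
have mD := @measurable_TS_Zo R n T a.
case: eqP => [_|/eqP a0]; first exact: measurable_cst.
set D := (X in measurable_fun X _).
have DTS : D `<=` TSs by exact: subIsetl.
have z1 p : D p -> (1 <= Zn (p.2 : 'rV[R]_n))%N.
  by move=> [_ /= zp]; rewrite -val_Zo zp lt0n.
have tl (p : timed) : D p -> [/\ inTS T (tlast (p.2 : 'rV[R]_n)) (uback p.2),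
    tstart (p.2 : 'rV[R]_n) = tlast (p.2 : 'rV[R]_n) & 0 <= tlast (p.2 : 'rV[R]_n) <= T].
  move=> Dp; have uU := inTS_inU (DTS _ Dp); have [h1 _ h2] := inTS_uback T0 uU (z1 _ Dp).
  by split=> //; rewrite -h2; exact: tstart_itv.
apply: measurable_fun_sumr => j; apply: measurable_funM.
  (* [tlast] gives way to [tstart], equal to it once a shock has occurred and known to be measurable
     on all of [TS]. *)
  apply: (@eq_measurable_fun _ _ _ _ D
    (fun p : timed => mu (tstart (p.2 : 'rV[R]_n)) (uback p.2) 0 j)).
    by move=> p /set_mem/tl[_ -> _].
  apply: (@measurable_comp _ _ _ _ _ _ TSs (fun p : timed => mu p.1 p.2 0 j) D
    (fun p : timed => (tstart (p.2 : 'rV[R]_n), uback p.2) : timed)) => //.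
  - by move=> _ [p /tl[h1 h2 _] <-]; rewrite /TS /= h2.
  - by apply: measurable_funS (@measurable_uback R n T).
pose e (b : 'I_S) (p : timed) : R := (b == i)%:R.
apply: (@measurable_fun_fin_case _ _ _ _ _ D (fun p : timed => J (tlast (p.2 : 'rV[R]_n)) j) e) => //;
  last by move=> b; exact: measurable_cst.
move=> b; rewrite (_ : _ `&` _ =
    D `&` (TSs `&` [set p | J (tstart (p.2 : 'rV[R]_n)) j = b])).
  apply: measurableI => //; apply: (@meas_J (fun p : timed => tstart (p.2 : 'rV[R]_n))).
    exact: measurable_tstart.
  by move=> p TSp; apply: tstart_itv => //; exact: inTS_inU TSp.
apply/seteqP; split=> p [Dp /=]; have [_ -> _] := tl _ Dp.
  by move=> h1; split=> //; split=> //; exact: DTS.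
by move=> [_ h1].
Qed.

Lemma step_exists mu v : simplex_valued mu -> bounded_by Bv v -> jmeas mu -> jmeas v ->
  exists nu w, [/\ is_step mu v nu w, simplex_valued nu, jmeas nu & jmeas w].
Proof.
move=> Pm Bd mm mv.
pose Cv := k0 + S%:R * (k0 * Bv) + k0 * (Bv + Bv).
have Cv0 : 0 <= Cv by rewrite !addr_ge0 ?mulr_ge0// ?mulr_ge0// ?addr_ge0.
have hPv i : exists P : R -> 'rV[R]_n -> R,
  [/\ measurable_fun [set: timed] (fun p : timed => P p.1 p.2),
      forall u s t, s <= t -> `|P t u - P s u| <= Cv * (t - s) &
      forall u, {ae leb, forall t, inTS T t u -> is_derive t (1 : R) (P^~ u) (rhsv mu v t u i)}].
  have [|P [h1 h2 h3 _]] := @primitive_exists R n T Cv (fun t u => rhsv mu v t u i) Cv0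
    (measurable_rhs_v i Pm mm mv).
    move=> t u tu; apply: rhs_v_bound => //; [exact: Pm|by move=> j; exact: Bd|].
    by move=> tu' _ j; exact: Bd.
  by exists P.
have [Pv hPv'] := choice hPv.
pose Cm := expR (k0 * T) * (k0 + k0).
have Cm0 : 0 <= Cm by rewrite mulr_ge0 ?addr_ge0 ?expR_ge0.
pose gm t u i := expR (k0 * t) * (rhsm mu v t u i + k0 * mu t u 0 i).
have gm0 t u i : inTS T t u -> 0 <= gm t u i.
  by move=> tu; rewrite mulr_ge0 ?expR_ge0//; apply: rhs_mu_ge => //; exact: Pm.
have hPm i : exists P : R -> 'rV[R]_n -> R,
  [/\ measurable_fun [set: timed] (fun p : timed => P p.1 p.2),
      forall u s t, s <= t -> `|P t u - P s u| <= Cm * (t - s),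
      forall u, {ae leb, forall t, inTS T t u -> is_derive t (1 : R) (P^~ u) (gm t u i)} &
      forall u s t, s <= t -> P s u <= P t u].
  have [|P [h1 h2 h3 h4]] := @primitive_exists R n T Cm (fun t u => gm t u i) Cm0
    (measurable_rhs_mu i Pm mm mv).
    move=> t u tu; rewrite normrM ger0_norm ?expR_ge0//; apply: ler_pM => //.
      by rewrite ler_expR ler_wpM2l//; have /andP[] := inTS_time tu.
    apply: le_trans (ler_normD _ _) _; apply: lerD.
      by apply: rhs_mu_bound => //; exact: Pm.
    rewrite normrM (ger0_norm k0ge0) -[leRHS]mulr1; apply: ler_wpM2l => //.
    by rewrite -(l1_inP (Pm _ _ tu)); exact: l1_coord.
  by exists P; split=> // u; apply: h4 => t tu; exact: gm0.
have [Pmu hPm'] := choice hPm.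
(* The constants of integration fit [w] to the terminal cost at time [T], and [nu] below to
   [initial mu u] at the time of the last shock. *)
pose w : state := fun t u => \row_i (Psi (Zo u) (mu T u) 0 i - Pv i T u + Pv i t u).
pose ic u i := expR (k0 * tstart u) * initial mu u 0 i - Pmu i (tstart u) u.
pose nu : state := fun t u => \row_i (expR (- k0 * t) * (ic u i + Pmu i t u)).
have enu u i : (fun t => expR (k0 * t) * nu t u 0 i) = (fun t => ic u i + Pmu i t u).
  by apply/funext => t; rewrite mxE mulrA -expRD mulNr subrr expR0 mul1r.
have nu_init u : nu (tstart u) u = initial mu u.
  apply/rowP => i; rewrite mxE /ic subrK mulrA -expRD mulNr addNr expR0 mul1r//.
have ac_nu u i : abs_cont_on [set t | inTS T t u] (fun t => expR (k0 * t) * nu t u 0 i).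
  rewrite enu; apply: (lipschitz_abs_cont Cm0) => s t _ _ st.
  by rewrite opprD addrACA subrr add0r; have [_ hP _ _] := hPm' i; exact: hP.
have d_nu u i : {ae leb, forall t, inTS T t u ->
    is_derive t (1 : R) (fun s => expR (k0 * s) * nu s u 0 i) (gm t u i)}.
  rewrite enu; have [_ _ hP _] := hPm' i.
  by apply: ae_impl (hP u) => t ht tu; apply: is_derive_cstD; exact: ht.
exists nu, w; split.
- split.
  + by move=> u i _; exact: ac_nu.
  + move=> u i _; apply: (lipschitz_abs_cont Cv0) => s t _ _ st.
    by rewrite !mxE opprD addrACA subrr add0r; have [_ hP _] := hPv' i; exact: hP.
  + by move=> u i _; exact: d_nu.
  + move=> u i _; have [_ _ hP] := hPv' i.
    rewrite (_ : (fun s => w s u 0 i) =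
      (fun s => Psi (Zo u) (mu T u) 0 i - Pv i T u + Pv i s u)); last first.
      by apply/funext => s; rewrite mxE.
    by apply: ae_impl (hP u) => t ht tu; apply: is_derive_cstD; exact: ht.
  + by move=> u uU; apply/rowP => i; rewrite mxE subrK.
  + have [_ z0] := inTS_u0 n T0.
    have := nu_init (u0 R n); rewrite /tstart /initial z0 eqxx; exact.
  + move=> u uU z1; have [_ _ ts] := inTS_uback T0 uU z1.
    by have := nu_init u; rewrite ts /initial gtn_eqF.
- move=> t u tu; have uU := inTS_inU tu.
  have tst : tstart u <= t by have /andP[] := (inTSP t T0 uU).1 tu.
  have [i0 i1] := initial_inP Pm uU.
  split.
    move=> i; rewrite mxE mulr_ge0 ?expR_ge0// /ic -addrA addr_ge0//.
      by rewrite mulr_ge0 ?expR_ge0.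
    by rewrite addrC subr_ge0; have [_ _ _ hP] := hPm' i; exact: hP.
  (* The weighted defect of total mass. Its derivative vanishes almost everywhere, as the rows of
     the intensity matrix sum to zero and [mu] has mass one; it is zero at the start, hence
     throughout. *)
  pose f r := \sum_i expR (k0 * r) * nu r u 0 i - expR (k0 * r) * 1.
  have fst0 : f (tstart u) = 0.
    by rewrite /f nu_init -mulr_sumr i1 subrr.
  have ft0 : `|f t - f (tstart u)| <= 0 * (t - tstart u).
    apply: (@abs_cont_lipschitz R f [set r | inTS T r u] _ _ _
      (fun r => \sum_i gm r u i - expR (k0 * r) * (0 + k0 * 1))) => //.
    + by apply: inTS_itv => //; exact: inTS_tstart.
    + apply: abs_contD; first by apply: abs_cont_sum => i; exact: ac_nu.
      apply: abs_contN; apply: (@abs_cont_expM R k0 T 1) => //; first exact: inTS_sub_itv.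
        by move=> r _; rewrite normr1.
      exact: abs_cont_cst.
    + apply: ae_impl (ae_forall_fin (d_nu u)) => r dr ru.
      apply: is_deriveB; last by apply: is_derive_expM; exact: is_derive_cst.
      have := @is_derive_sum _ _ _ _ (fun i s => expR (k0 * s) * nu s u 0 i) r 1
        (fun i => gm r u i) (fun i => dr i ru).
      rewrite (_ : \sum_(i < S) _ = (fun s => \sum_i expR (k0 * s) * nu s u 0 i))//.
      by apply/funext => s; rewrite fct_sumE.
    + move=> r ru; rewrite /gm -mulr_sumr big_split/= rhs_mu_sum//; last exact: Pm.
      by rewrite -mulr_sumr (Pm _ _ ru).2 subrr normr0.
  move: ft0; rewrite mul0r fst0 subr0 normr_le0 /f -mulr_sumr -mulrBr mulf_eq0.
  by rewrite gt_eqF ?expR_gt0//= subr_eq0 => /eqP.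
- move=> i; rewrite (_ : (fun _ => _) =
    fun p : timed => expR (- k0 * p.1) * (ic p.2 i + Pmu i p.1 p.2)); last first.
    by apply/funext => p; rewrite mxE.
  have [mP _ _ _] := hPm' i.
  apply: measurable_funM.
    apply: (measurableT_comp (@measurable_expR R)); apply: measurable_funM.
      exact: measurable_cst.
    exact: measurable_time.
  apply: measurable_funD; last exact: measurable_funTS mP.
  apply: measurable_funB.
    apply: measurable_funM; last exact: measurable_initial.
    apply: (measurableT_comp (@measurable_expR R)); apply: measurable_funM.
      exact: measurable_cst.
    exact: measurable_tstart.
  exact: (measurableT_comp mP (measurable_at_time (@measurable_tstart R n T))).
- move=> i; rewrite (_ : (fun _ => _) = fun p : timed =>
    Psi (Zo (p.2 : 'rV[R]_n)) (mu T p.2) 0 i - Pv i T p.2 + Pv i p.1 p.2); last first.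
    by apply/funext => p; rewrite mxE.
  have [mP _ _] := hPv' i.
  apply: measurable_funD; last exact: measurable_funTS mP.
  apply: measurable_funB; first exact: meas_Psi.
  exact: (measurableT_comp mP (measurable_at_time (@measurable_cst _ _ _ _ TSs T))).
Qed.

Lemma near_states_tri D mu v mu' v' nu w : near_states D nu w mu v ->
  near_states D nu w mu' v' -> near_states (D + D) mu v mu' v'.
Proof.
move=> h1 h2 t u tu; have [a1 b1] := h1 _ _ tu; have [a2 b2] := h2 _ _ tu; split.
  have -> : mu t u - mu' t u = (nu t u - mu' t u) - (nu t u - mu t u).
    by rewrite opprB [RHS]addrC subrKA.
  by apply: le_trans (l1B _ _) _; rewrite mulrDl; exact: lerD.
move=> i; rewrite mulrDl; apply: le_trans (ler_distD (w t u 0 i) _ _) _.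
by rewrite distrC; exact: lerD.
Qed.

Definition admissible (x : state * state) : Prop :=
  [/\ simplex_valued x.1, bounded_by Bv x.2, jmeas x.1 & jmeas x.2].

Lemma picard_exists : exists X : nat -> state * state, forall k,
  admissible (X k) /\ is_step (X k).1 (X k).2 (X k.+1).1 (X k.+1).2.
Proof.
(* A step is available from admissible states only, whereas iteration wants a total function: other
   states are sent to themselves. *)
have F_ex (x : state * state) : exists y : state * state, admissible x ->
    admissible y /\ is_step x.1 x.2 y.1 y.2.
  have [[Pm Bd mm mv]|nx] := pselect (admissible x); last by exists x.
  have [nu [w [st Pn mn mw]]] := step_exists Pm Bd mm mv.
  exists (nu, w) => _; split=> //; split=> //; exact: step_bounded Pm Bd st.
have [F hF] := choice F_ex.
pose x0 : state * state := (fun _ _ => m0, fun _ _ => 0).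
have ad0 : admissible x0.
  by split=> // t u i _; rewrite mxE normr0.
exists (fun k => iter k F x0) => k.
have ad : admissible (iter k F x0) by elim: k => //= k ih; have [] := hF _ ih.
by split=> //=; have [] := hF _ ad.
Qed.

(** The limit and the step taken from it both lie within [G / 2 ^ k.+1] of the iterate [X k.+1], the
    second by contraction; so they are within [G / 2 ^ k] of each other for every [k] and coincide
    on [TS]. *)
Lemma fixpoint_exists : exists mu v, simplex_valued mu /\
  is_solution T lam Q psi Psi J h mu v m0.
Proof.
have [X hX] := picard_exists.
pose D0 := 2 * Bv; have D00 : 0 <= D0 by rewrite mulr_ge0.
have pw k : 0 <= D0 / 2 ^+ k by rewrite divr_ge0// exprn_ge0.
have nrX k : near_states (D0 / 2 ^+ k) (X k).1 (X k).2 (X k.+1).1 (X k.+1).2.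
  elim: k => [|k ih].
    rewrite expr0 divr1; have [[Pm Bd _ _] _] := hX 0%N; have [[Pm' Bd' _ _] _] := hX 1%N.
    exact: near_states_init.
  have [[Pm Bd _ _] st] := hX k; have [[Pm' Bd' _ _] st'] := hX k.+1.
  rewrite exprSr invfM mulrA.
  exact: (contraction (pw k) Pm Pm' Bd st st' ih).
(* Off [TS] these limits may be junk values; everything claimed about them is restricted to [TS]. *)
pose mu : state := fun t u => \row_i limn (fun k => (X k).1 t u 0 i).
pose v : state := fun t u => \row_i limn (fun k => (X k).2 t u 0 i).
pose Ca := D0 * wa; pose Cb := D0 * wb.
have Ca0 : 0 <= Ca by rewrite mulr_ge0.
have Cb0 : 0 <= Cb by rewrite mulr_ge0.
have limm t u i : inTS T t u ->
    (fun k => (X k).1 t u 0 i) @ \oo --> mu t u 0 i /\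
    forall k, `|(X k).1 t u 0 i - mu t u 0 i| <= 2 * Ca / 2 ^+ k.
  move=> tu; rewrite mxE; apply: geometric_limit => // k.
  have := near_states_max (pw k) (nrX k) tu; rewrite mulrAC; apply: le_trans.
  by have := l1_coord ((X k).1 t u - (X k.+1).1 t u) i; rewrite !mxE.
have limv t u i : inTS T t u ->
    (fun k => (X k).2 t u 0 i) @ \oo --> v t u 0 i /\
    forall k, `|(X k).2 t u 0 i - v t u 0 i| <= 2 * Cb / 2 ^+ k.
  move=> tu; rewrite mxE; apply: geometric_limit => // k.
  by have [_ /(_ i)] := nrX k _ _ tu; rewrite mulrAC.
have Pmu : simplex_valued mu.
  move=> t u tu; split.
    move=> i; rewrite -oppr_le0; apply: (@pow2_le0 _ _ (2 * Ca)); first by rewrite mulr_ge0.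
    move=> k; have [_ /(_ k)] := limm t u i tu; rewrite ler_norml => /andP[_].
    by have [[Pk _ _ _] _] := hX k; have := (Pk _ _ tu).1 i; move: (2 * Ca / _) => z; lra.
  apply/eqP; rewrite -subr_eq0 -normr_le0.
  apply: (@pow2_le0 _ _ (S%:R * (2 * Ca))); first by rewrite !mulr_ge0.
  move=> k; have [[Pk _ _ _] _] := hX k; rewrite -[X in `|_ - X|](Pk _ _ tu).2 -sumrB -mulrA.
  apply: ler_norm_sum_cst => j; rewrite distrC.
  by have [_ /(_ k)] := limm t u j tu.
have Bdv : bounded_by Bv v.
  move=> t u i tu; rewrite -subr_le0; apply: (@pow2_le0 _ _ (2 * Cb)); first by rewrite mulr_ge0.
  move=> k; have [_ /(_ k)] := limv t u i tu; have [[_ Bk _ _] _] := hX k.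
  have := Bk _ _ i tu; have := ler_normB ((X k).2 t u 0 i) ((X k).2 t u 0 i - v t u 0 i).
  by rewrite subKr; move: (2 * Cb / _) => z; lra.
have mmu : jmeas mu.
  move=> i; apply: (@measurable_fun_cvg _ _ _ TSs (fun k (p : timed) => (X k).1 p.1 p.2 0 i)) => //.
    by move=> k; have [[_ _ mk _] _] := hX k; exact: mk.
  by move=> p TSp; have [] := limm p.1 p.2 i TSp.
have mv : jmeas v.
  move=> i; apply: (@measurable_fun_cvg _ _ _ TSs (fun k (p : timed) => (X k).2 p.1 p.2 0 i)) => //.
    by move=> k; have [[_ _ _ mk] _] := hX k; exact: mk.
  by move=> p TSp; have [] := limv p.1 p.2 i TSp.
(* Turns coordinatewise rates into [near_states]: the first summand pays for adding [S] coordinates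
   in [l1], the second for [v], where [Cb] already contains the weight [wb]. *)
pose G := S%:R * (2 * Ca) + 2 * D0.
have G0 : 0 <= G by rewrite addr_ge0// !mulr_ge0.
have pG k : 0 <= G / 2 ^+ k by rewrite divr_ge0// exprn_ge0.
have G1 : S%:R * (2 * Ca) <= G by rewrite lerDl mulr_ge0.
have G2 : 2 * D0 <= G by rewrite lerDr !mulr_ge0.
have nrlim k : near_states (G / 2 ^+ k) (X k).1 (X k).2 mu v.
  have p2 : 0 <= (2 ^+ k)^-1 :> R by rewrite invr_ge0 exprn_ge0.
  move=> t u tu; split.
    apply: (@le_trans _ _ (S%:R * (2 * Ca / 2 ^+ k))).
      by apply: l1_le => j; have [_ /(_ k)] := limm t u j tu; rewrite !mxE.
    apply: (@le_trans _ _ (G / 2 ^+ k)); first by rewrite mulrA ler_wpM2r.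
    by rewrite ler_peMr// exprn_ege1// ler1n.
  move=> i; have [_ /(_ k)] := limv t u i tu; move=> hk; apply: le_trans hk _.
  rewrite /Cb mulrA mulrAC ler_wpM2r//; exact: ler_wpM2r.
have [nu [w [st Pn _ _]]] := step_exists Pmu Bdv mmu mv.
have nrnu k : near_states (G / 2 ^+ k) mu v nu w.
  have [[Pk Bk _ _] stk] := hX k.
  have h1 := contraction (pG k) Pk Pmu Bk stk st (nrlim k).
  have h2 := nrlim k.+1; rewrite exprSr invfM mulrA in h2.
  have := near_states_tri h2 h1.
  by rewrite -[X in near_states X](splitr (G / 2 ^+ k)).
exists nu, w; split=> //; apply: (step_solution st) => // t u tu; split.
  apply: l1_eq0; apply: (@pow2_le0 _ _ (G * 4 ^+ Zn u)); first by rewrite mulr_ge0// exprn_ge0.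
  by move=> k; have [h1 _] := nrnu k _ _ tu; rewrite mulrAC.
apply/rowP => i; apply/eqP; rewrite -subr_eq0 -normr_le0.
apply: (@pow2_le0 _ _ (G * wb)); first by rewrite mulr_ge0.
by move=> k; have [_ h2] := nrnu k _ _ tu; rewrite mulrAC.
Qed.

Lemma solution_exists_unique : exists mu v,
  is_solution T lam Q psi Psi J h mu v m0 /\
  forall mu' v', is_solution T lam Q psi Psi J h mu' v' m0 ->
  forall t u, inTS T t u -> mu' t u = mu t u /\ v' t u = v t u.
Proof.
have [mu [v [Pm sol]]] := fixpoint_exists.
exists mu, v; split=> // mu' v' sol' t u tu.
have Pm' : simplex_valued mu' by case: sol'.
exact: (fixpoint_unique Pm' Pm (solution_is_step sol') (solution_is_step sol)).
Qed.

End Scheme.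

(** * Borel coefficients *)

Section BorelCoefficients.
Variables (R : realType) (n S dA : nat) (T : R) (Aset : set 'rV[R]_dA).
Variables (lam : R -> 'rV[R]_S -> 'rV[R]_n)
          (Psi : 'I_n.+1 -> 'rV[R]_S -> 'rV[R]_S)
          (J : R -> 'I_S -> 'I_S)
          (h : R -> 'rV[R]_n -> 'rV[R]_S -> 'rV[R]_S -> 'M[R]_(S, dA)).
Hypothesis T0 : 0 <= T.
Local Notation hist := (g_sigma_algebraType (@open 'rV[R]_n)).
Local Notation timed := (measurableTypeR R * hist)%type.
Local Notation TSs := (@TS R n T).
Local Notation state := (R -> 'rV[R]_n -> 'rV[R]_S).
Hypothesis h_borel : borel_fun [set p : R * 'rV[R]_n * 'rV[R]_S * 'rV[R]_S |
               inTS T p.1.1.1 p.1.1.2 /\ inP p.1.2]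
            (fun p => h p.1.1.1 p.1.1.2 p.1.2 p.2).
Hypothesis h_Aset : forall t u m v, inTS T t u -> inP m -> forall i, Aset (row i (h t u m v)).
Variables (mu v : state).
Hypotheses (Pmu : simplex_valued T mu) (mmu : jmeas T mu) (mv : jmeas T v).

Let mTS : measurable TSs. Proof. exact: measurable_TS. Qed.

Lemma bmeas_time : bmeas TSs (fun p : timed => p.1 : R).
Proof. by apply: bmeas_R => //; exact: measurable_time. Qed.

Lemma bmeas_hist : bmeas TSs (fun p : timed => p.2 : 'rV[R]_n).
Proof. by apply: bmeas_mx => // i j; rewrite (ord1 i); exact: measurable_hist_coord. Qed.

Lemma bmeas_state (f : state) : jmeas T f -> bmeas TSs (fun p : timed => f p.1 p.2).
Proof. by move=> mf; apply: bmeas_mx => // i j; rewrite (ord1 i); exact: mf. Qed.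

(** [h] is composed with [(t, u, mu, v)], which is Borel into the fourfold product since every
    factor has a countable base. *)
Lemma bmeas_row i : bmeas TSs (fun p : timed => row i (h p.1 p.2 (mu p.1 p.2) (v p.1 p.2))).
Proof.
have b4 : bmeas TSs (fun p : timed => (((p.1 : R, p.2 : 'rV[R]_n), mu p.1 p.2), v p.1 p.2)).
  apply: bmeas_pair => //; [|exact: countable_base_mx| |exact: bmeas_state].
    apply: countable_base_prod; last exact: countable_base_mx.
    by apply: countable_base_prod; [exact: countable_base_R|exact: countable_base_mx].
  apply: bmeas_pair => //; [|exact: countable_base_mx| |exact: bmeas_state].
    by apply: countable_base_prod; [exact: countable_base_R|exact: countable_base_mx].
  apply: bmeas_pair => //; [exact: countable_base_R|exact: countable_base_mx| |].
    exact: bmeas_time.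
  exact: bmeas_hist.
have bh : bmeas TSs (fun p : timed => h p.1 p.2 (mu p.1 p.2) (v p.1 p.2)).
  by apply: (bmeas_borel_comp h_borel b4) => p TSp; split=> //; exact: Pmu.
apply: bmeas_mx => // k j.
rewrite (_ : (fun _ => _) = fun p : timed => h p.1 p.2 (mu p.1 p.2) (v p.1 p.2) i j).
  exact: bmeas_coord.
by apply/funext => p; rewrite mxE.
Qed.

(** The matrix shape is left free so that one statement covers [Q], read at entry [(i, j)], and
    [psi], a matrix with one row, both under the control of state [i]. *)
Lemma measurable_feedback m' n' (F : R -> 'I_n.+1 -> 'rV[R]_S -> 'rV[R]_dA -> 'M[R]_(m', n'))
    (i : 'I_S) (a : 'I_m') (b : 'I_n') :
  (forall k, borel_fun
     [set p : R * 'rV[R]_S * 'rV[R]_dA | 0 <= p.1.1 <= T /\ inP p.1.2 /\ Aset p.2]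
     (fun p => F p.1.1 k p.1.2 p.2)) ->
  measurable_fun TSs (fun p : timed => F p.1 (Zo (p.2 : 'rV[R]_n)) (mu p.1 p.2)
    (row i (h p.1 p.2 (mu p.1 p.2) (v p.1 p.2))) a b).
Proof.
move=> F_borel.
pose f (k : 'I_n.+1) (p : timed) : R := F p.1 k (mu p.1 p.2)
    (row i (h p.1 p.2 (mu p.1 p.2) (v p.1 p.2))) a b.
apply: (@measurable_TS_case R n T _ _ f) => k.
apply: (measurable_funS mTS (@subIsetl _ _ _)).
have b3 : bmeas TSs (fun p : timed =>
    ((p.1 : R, mu p.1 p.2), row i (h p.1 p.2 (mu p.1 p.2) (v p.1 p.2)))).
  apply: bmeas_pair => //; [|exact: countable_base_mx| |exact: bmeas_row].
    by apply: countable_base_prod; [exact: countable_base_R|exact: countable_base_mx].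
  apply: bmeas_pair => //; [exact: countable_base_R|exact: countable_base_mx| |].
    exact: bmeas_time.
  exact: bmeas_state.
apply: (@bmeas_coord R _ _ _ _ TSs
  (fun p : timed => F p.1 k (mu p.1 p.2) (row i (h p.1 p.2 (mu p.1 p.2) (v p.1 p.2))))) => //.
apply: (bmeas_borel_comp (F_borel k) b3) => p TSp /=.
split; first exact: inTS_time TSp.
by split; [exact: Pmu|apply: h_Aset => //; exact: Pmu].
Qed.

Lemma measurable_intensity k :
  borel_fun [set p : R * 'rV[R]_S | 0 <= p.1 <= T /\ inP p.2] (fun p => lam p.1 p.2) ->
  measurable_fun TSs (fun p : timed => lam p.1 (mu p.1 p.2) 0 k).
Proof.
move=> lam_borel.
have b2 : bmeas TSs (fun p : timed => (p.1 : R, mu p.1 p.2)).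
  apply: bmeas_pair => //; [exact: countable_base_R|exact: countable_base_mx| |].
    exact: bmeas_time.
  exact: bmeas_state.
apply: (@bmeas_coord R _ _ _ _ TSs (fun p : timed => lam p.1 (mu p.1 p.2))) => //.
apply: (bmeas_borel_comp lam_borel b2) => p TSp /=.
by split; [exact: inTS_time TSp|exact: Pmu].
Qed.

Lemma measurable_terminal i : (forall k, borel_fun [set m : 'rV[R]_S | inP m] (Psi k)) ->
  measurable_fun TSs (fun p : timed => Psi (Zo (p.2 : 'rV[R]_n)) (mu T p.2) 0 i).
Proof.
move=> Psi_borel.
pose f (k : 'I_n.+1) (p : timed) : R := Psi k (mu T p.2) 0 i.
apply: (@measurable_TS_case R n T _ _ f) => k.
apply: (measurable_funS mTS (@subIsetl _ _ _)).
have TSend p : TSs p -> inTS T T p.2 by move=> TSp; exact/inTS_end/(inTS_inU TSp).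
have bT : bmeas TSs (fun p : timed => mu T p.2).
  apply: bmeas_mx => // a b; rewrite (ord1 a).
  apply: (@measurable_comp _ _ _ _ _ _ TSs (fun p : timed => mu p.1 p.2 0 b) TSs
    (fun p : timed => (T, p.2) : timed)) => //.
    by move=> _ [p /TSend Tp <-]; exact: Tp.
  exact: (measurable_at_time (@measurable_cst _ _ _ _ TSs T)).
apply: (@bmeas_coord R _ _ _ _ TSs (fun p : timed => Psi k (mu T p.2))) => //.
by apply: (bmeas_borel_comp (Psi_borel k) bT) => p /TSend; exact: Pmu.
Qed.

Lemma measurable_shock (s : timed -> R) i j : measurable_fun TSs s ->
  (forall p, TSs p -> 0 <= s p <= T) ->
  (exists C : set R, borel_set C /\
     [set t | (0 <= t <= T) /\ J t i = j] = [set t | 0 <= t <= T] `&` C) ->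
  measurable (TSs `&` [set p | J (s p) i = j]).
Proof.
move=> ms sT [C [bC hC]].
rewrite (_ : _ `&` _ = TSs `&` s @^-1` C).
  by apply: ms => //; exact: borel_measurable_R.
apply/seteqP; split=> p [TSp /= hp]; split=> //.
  have : ([set t | 0 <= t <= T] `&` C) (s p) by rewrite -hC; split=> //; exact: sT.
  by case.
have : [set t | 0 <= t <= T /\ J t i = j] (s p) by rewrite hC; split=> //; exact: sT.
by case.
Qed.

End BorelCoefficients.

Theorem theorem3p11 (R : realType) (n S : nat) (K L : R) :
  exists T0 : R, 0 < T0 /\
  forall T : R, 0 < T -> T <= T0 ->
  forall (dA : nat) (Aset : set 'rV[R]_dA)
    (lam : R -> 'rV[R]_S -> 'rV[R]_n)
    (Q : R -> 'I_n.+1 -> 'rV[R]_S -> 'rV[R]_dA -> 'M[R]_S)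
    (psi : R -> 'I_n.+1 -> 'rV[R]_S -> 'rV[R]_dA -> 'rV[R]_S)
    (Psi : 'I_n.+1 -> 'rV[R]_S -> 'rV[R]_S)
    (J : R -> 'I_S -> 'I_S)
    (h : R -> 'rV[R]_n -> 'rV[R]_S -> 'rV[R]_S -> 'M[R]_(S, dA)),
  (* lambda: positive, bounded by K, Borel on [0,T] x P(S) *)
  (forall t m, 0 <= t <= T -> inP m -> forall k, 0 < lam t m 0 k <= K) ->
  borel_fun [set p : R * 'rV[R]_S | 0 <= p.1 <= T /\ inP p.2]
            (fun p => lam p.1 p.2) ->
  (* Q: intensity matrices, bounded by K, Borel *)
  (forall t k m a, 0 <= t <= T -> inP m -> Aset a ->
     (forall i j, i != j -> 0 <= Q t k m a i j) /\
     (forall i, \sum_j Q t k m a i j = 0) /\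
     (forall i j, `|Q t k m a i j| <= K)) ->
  (forall k, borel_fun
     [set p : R * 'rV[R]_S * 'rV[R]_dA | 0 <= p.1.1 <= T /\ inP p.1.2 /\ Aset p.2]
     (fun p => Q p.1.1 k p.1.2 p.2)) ->
  (* psi: bounded by K, Borel *)
  (forall t k m a, 0 <= t <= T -> inP m -> Aset a ->
     forall i, `|psi t k m a 0 i| <= K) ->
  (forall k, borel_fun
     [set p : R * 'rV[R]_S * 'rV[R]_dA | 0 <= p.1.1 <= T /\ inP p.1.2 /\ Aset p.2]
     (fun p => psi p.1.1 k p.1.2 p.2)) ->
  (* Psi: bounded by K, Borel *)
  (forall k m, inP m -> forall i, `|Psi k m 0 i| <= K) ->
  (forall k, borel_fun [set m : 'rV[R]_S | inP m] (Psi k)) ->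
  (* J (independent of m): Borel in t *)
  (forall i j, exists C : set R, borel_set C /\
     [set t | (0 <= t <= T) /\ J t i = j] = [set t | 0 <= t <= T] `&` C) ->
  (* h: Borel selection of the argmax *)
  borel_fun [set p : R * 'rV[R]_n * 'rV[R]_S * 'rV[R]_S |
               inTS T p.1.1.1 p.1.1.2 /\ inP p.1.2]
            (fun p => h p.1.1.1 p.1.1.2 p.1.2 p.2) ->
  (forall t u m v, inTS T t u -> inP m -> forall i,
     Aset (row i (h t u m v)) /\
     forall a, Aset a ->
       psi t (Zo u) m a 0 i + \sum_j Q t (Zo u) m a i j * v 0 j <=
       psi t (Zo u) m (row i (h t u m v)) 0 i
         + \sum_j Q t (Zo u) m (row i (h t u m v)) i j * v 0 j) ->
  (* hat psi, hat Q Lipschitz in (m,v) uniformly in (t,u) *)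
  (forall t u, inTS T t u -> forall m m' v v', inP m -> inP m' ->
     (forall i, `|psihat psi h t u m v i - psihat psi h t u m' v' i|
                  <= L * (l1 (m - m') + l1 (v - v'))) /\
     (forall i j, `|Qhat Q h t u m v i j - Qhat Q h t u m' v' i j|
                  <= L * (l1 (m - m') + l1 (v - v')))) ->
  (* Psi(k,.) and lambda^k(t,.) Lipschitz in m uniformly in k, t *)
  (forall k m m', inP m -> inP m' -> forall i,
     `|Psi k m 0 i - Psi k m' 0 i| <= L * l1 (m - m')) ->
  (forall t, 0 <= t <= T -> forall m m', inP m -> inP m' -> forall k,
     `|lam t m 0 k - lam t m' 0 k| <= L * l1 (m - m')) ->
  forall m0 : 'rV[R]_S, inP m0 ->
  exists mu v : R -> 'rV[R]_n -> 'rV[R]_S,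
    is_solution T lam Q psi Psi J h mu v m0 /\
    forall mu' v' : R -> 'rV[R]_n -> 'rV[R]_S,
      is_solution T lam Q psi Psi J h mu' v' m0 ->
      forall t u, inTS T t u -> mu' t u = mu t u /\ v' t u = v t u.
Proof.
(* [K] and [L] are arbitrary reals; absolute values make them usable as nonnegative bounds. *)
pose k0 := `|K|; pose L0 := `|L|; pose Bv := k0 + 1; pose wa : R := 4 ^+ n.
pose wb := 4 * L0 * wa + 1.
have k0ge0 : 0 <= k0 by exact: normr_ge0.
have L0ge0 : 0 <= L0 by exact: normr_ge0.
have Bv0 : 0 <= Bv by rewrite addr_ge0.
have wa0 : 0 <= wa by exact: exprn_ge0.
have wb0 : 0 <= wb by rewrite addr_ge0// !mulr_ge0.
pose X2 := k0 + S%:R * (k0 * Bv) + k0 * (Bv + Bv).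
pose X3 := S%:R * k0 + k0.
pose X4 := S%:R * (expR 1 * (k0 * wa + L0 * (wa + S%:R * wb) + k0 * wa)).
pose X5 := L0 * (wa + S%:R * wb) + S%:R * (L0 * (wa + S%:R * wb) * Bv + k0 * wb) +
    (L0 * wa * (2 * Bv) + k0 * (2 * wb)).
have X20 : 0 <= X2 by rewrite !addr_ge0// !mulr_ge0// ?addr_ge0.
have X30 : 0 <= X3 by rewrite addr_ge0// mulr_ge0.
have waS : 0 <= wa + S%:R * wb by rewrite addr_ge0// mulr_ge0.
have X40 : 0 <= X4.
  by rewrite mulr_ge0// mulr_ge0 ?expR_ge0// !addr_ge0// mulr_ge0.
have X50 : 0 <= X5.
  by rewrite !addr_ge0 ?mulr_ge0// ?addr_ge0 ?mulr_ge0// ?mulr_ge0.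
(* [W] dominates each factor multiplying [T] in the smallness conditions, so the single bound
   [T <= 1 / (4 * W)] implies them all; the summand 1 keeps it positive. *)
pose W := 1 + k0 + X2 + X3 + X4 + X5.
have W0 : 0 < W by rewrite /W; lra.
exists (1 / (4 * W)); split; first by rewrite divr_gt0// mulr_gt0.
move=> T Tgt0; rewrite ler_pdivlMr ?mulr_gt0// => TW.
have T0 : 0 <= T by exact: ltW.
have small X : X <= W -> T * X <= 1 / 4.
  move=> XW; apply: (@le_trans _ _ (T * W)); first exact: ler_wpM2l.
  lra.
move=> dA Aset lam Q psi Psi J h lam_bd lam_borel Q_int Q_borel psi_bd psi_borel
  Psi_bd Psi_borel J_borel h_borel h_max hat_lip Psi_lip lam_lip m0 m0P.
have KK x : x <= K -> x <= k0 by move=> xK; apply: le_trans xK (ler_norm _).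
have LL x y : 0 <= y -> x <= L * y -> x <= L0 * y.
  by move=> y0 xL; apply: le_trans xL _; apply: ler_wpM2r => //; exact: ler_norm.
have h_A t u m v : inTS T t u -> inP m -> forall i, Aset (row i (h t u m v)).
  by move=> tu Pm i; have [] := h_max t u m v tu Pm i.
have Qh t u m v i (tu : inTS T t u) (Pm : inP m) :=
  Q_int t (Zo u) m _ (inTS_time tu) Pm (h_A t u m v tu Pm i).
apply: (@solution_exists_unique R n S dA T k0 L0 lam Q psi Psi J h m0 _ _ _ _ _ _ _ _ _ _ _ _ _
  Bv wa wb) => //.
- by move=> t u m v tu Pm i j ij; have [q1 _] := Qh t u m v i tu Pm; exact: q1.
- by move=> t u m v tu Pm i; have [_ [q2 _]] := Qh t u m v i tu Pm; exact: q2.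
- by move=> t u m v tu Pm i j; have [_ [_ q3]] := Qh t u m v i tu Pm; exact/KK/q3.
- move=> t u m v tu Pm i; apply: KK.
  exact: (psi_bd t (Zo u) m _ (inTS_time tu) Pm (h_A t u m v tu Pm i) i).
- move=> t m tT Pm k; have /andP[l0 lK] := lam_bd t m tT Pm k.
  by rewrite ger0_norm; [exact: KK|exact: ltW].
- by move=> k m Pm i; exact/KK/Psi_bd.
- move=> t u tu m m' v v' Pm Pm' i; apply: LL; first by rewrite addr_ge0// l1_ge0.
  by have [h1 _] := hat_lip t u tu m m' v v' Pm Pm'; exact: h1.
- move=> t u tu m m' v v' Pm Pm' i j; apply: LL; first by rewrite addr_ge0// l1_ge0.
  by have [_ h1] := hat_lip t u tu m m' v v' Pm Pm'; exact: h1.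
- by move=> k m m' Pm Pm' i; apply: LL; [exact: l1_ge0|exact: Psi_lip].
- by move=> t tT m m' Pm Pm' k; apply: LL; [exact: l1_ge0|exact: lam_lip].
- rewrite mulrC; apply: le_trans (small k0 _) _; first by rewrite /W; lra.
  lra.
- apply: le_trans (small X2 _) _; first by rewrite /W; lra.
  lra.
- apply: le_trans (small X3 _) _; first by rewrite /W; lra.
  lra.
- by apply: (small X4); rewrite /W; lra.
- by apply: (small X5); rewrite /W; lra.
- by move=> mu v Pm mm mv i; exact: (measurable_feedback h_borel h_A Pm mm mv i 0 i psi_borel).
- by move=> mu v Pm mm mv i j; exact: (measurable_feedback h_borel h_A Pm mm mv i i j Q_borel).
- by move=> mu Pm mm k; exact: (measurable_intensity Pm mm k lam_borel).
- by move=> mu Pm mm i; exact: (measurable_terminal T0 Pm mm i Psi_borel).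
- by move=> s ms sT i j; exact: (measurable_shock ms sT (J_borel i j)).
Qed.
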